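(* Let $\mathcal U$ be an upper cluster algebra with principal coefficients at $t_0$. Let $M, N$ be two monomials in non-initial cluster variables of $\mathcal U$ and $F_M, F_N$ their $F$-polynomials. If $F_M=F_N$, then $M=N$. In particular, ${\bf g}_M={\bf g}_N$, where ${\bf g}_M$ and ${\bf g}_N$ are the $g$-vectors of $M$ and $N$.
   Context: Throughout, $\mathbb K$ is a factorial domain (UFD) of characteristic $0$. A semifield $(\mathbb P,\oplus,\cdot)$ is an abelian multiplicative group with a commutative, associative operation $\oplus$ over which multiplication distributes; $\mathbb{KP}$ is its group ring over $\mathbb K$, and $\mathcal F$ is the field of rational functions in $n$ independent variables with coefficients in $\mathbb{KP}$. An integer $n\times n$ matrix $B$ is skew-symmetrizable if $SB$ is skew-symmetric for some integer diagonal matrix $S$ with positive diagonal entries. A (labeled) $\mathscr A$-seed over $\mathbb P$ is a triple $(B,X,A)$ with $B=(b_{ij})$ an $n\times n$ skew-symmetrizable integer matrix, $X=(X_1,\ldots,X_n)\in\mathbb P^n$, and $A=(A_1,\ldots,A_n)$ a free generating set of $\mathcal F$ over $\mathbb{KP}$. Its $k$-th exchange binomial is $P_k=\frac{X_k}{1\oplus X_k}\prod_{b_{jk}>0}A_j^{b_{jk}}+\frac{1}{1\oplus X_k}\prod_{b_{jk}<0}A_j^{-b_{jk}}$. The mutation $\mu_k(B,X,A)=(B',X',A')$ is: $b'_{ij}=-b_{ij}$ if $i=k$ or $j=k$, else $b'_{ij}=b_{ij}+\mathrm{sgn}(b_{ik})\max(b_{ik}b_{kj},0)$; $X'_k=X_k^{-1}$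 and $X'_i=X_iX_k^{\max(b_{ki},0)}(1\oplus X_k)^{-b_{ki}}$ for $i\ne k$; $A'_i=A_i$ for $i\neq k$ and $A'_k=A_k^{-1}P_k$. Let $\mathbb T_n$ be the $n$-regular tree with edges labeled $1,\ldots,n$ so that edges at each vertex have distinct labels. An $\mathscr A$-seed pattern assigns to each vertex $t$ a seed $(B_t,X_t,A_t)$, $B_t=(b^t_{ij})$, $X_t=(X_{1;t},\ldots,X_{n;t})$, $A_t=(A_{1;t},\ldots,A_{n;t})$, such that seeds at vertices joined by an edge labeled $k$ are related by $\mu_k$. A vertex $t_0$ is chosen as initial; the $A_{i;t_0}$ are the initial cluster variables. The upper cluster algebra is $\mathcal U=\bigcap_{t}\mathbb{KP}[A_{1;t}^{\pm1},\ldots,A_{n;t}^{\pm1}]$. The $A_{k;t}$ are the cluster variables (they lie in $\mathcal U$). Principal coefficients at $t_0$: $\mathbb P=\mathrm{Trop}(Z_1,\ldots,Z_n)$, the free abelian group on $Z_1,\ldots,Z_n$ with $\prod Z_i^{a_i}\oplus\prod Z_i^{b_i}=\prod Z_i^{\min(a_i,b_i)}$, and $X_{i;t_0}=Z_i$ for $i=1,\ldots,n$. In this case every cluster variable $A_{k;t}$ lies in $\mathbb Z[Z_1,\ldots,Z_n][A_{1;t_0}^{\pm1},\ldots,A_{n;t_0}^{\pm1}]$ (known), and its $F$-polynomial is $F_{k;t}(Z_1,\ldots,Z_n):=A_{k;t}|_{A_{1;t_0}=\cdots=A_{n;t_0}=1}\in\mathbb Z[Z_1,\ldots,Z_n]$.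 Its $g$-vector is the unique ${\bf g}=(g_1,\ldots,g_n)^{\rm T}\in\mathbb Z^n$ with $A_{k;t}=\left(\prod_i A_{i;t_0}^{g_i}\right)F_{k;t}(\widehat X_{1},\ldots,\widehat X_{n})$, where $\widehat X_{j}=Z_j\prod_{i}A_{i;t_0}^{b_{ij}^{t_0}}$ (existence and uniqueness are known). A monomial in (non-initial) cluster variables is a finite product $M=\prod_{i=1}^s M_i$ of (non-initial) cluster variables, not necessarily from a common cluster; $F_M:=\prod_i F_{M_i}$ and ${\bf g}_M:=\sum_i{\bf g}_{M_i}$, where $F_{M_i}$, ${\bf g}_{M_i}$ are the $F$-polynomial and $g$-vector of $M_i$. *)

(* Defs.v *)
From Stdlib Require Import ClassicalEpsilon.
From mathcomp Require Import all_boot all_order all_algebra.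
From mathcomp.multinomials Require Import mpoly.

Set Implicit Arguments.
Unset Strict Implicit.
Unset Printing Implicit Defensive.

Import Order.TTheory GRing.Theory Num.Theory.
Local Open Scope ring_scope.

(* ---- Factorial domains ---- *)

Definition irreducible_elt (R : idomainType) (p : R) : Prop :=
  [/\ p != 0, p \isn't a GRing.unit &
      forall a b : R, p = a * b -> a \is a GRing.unit \/ b \is a GRing.unit].

Definition associates (R : idomainType) (a b : R) : Prop :=
  exists2 u : R, u \is a GRing.unit & b = u * a.

Definition factorial_domain (R : idomainType) : Prop :=
  (forall x : R, x != 0 ->
     exists2 s : seq R, (forall p, p \in s -> irreducible_elt p)
                      & associates (\prod_(p <- s) p) x)
  /\
  (forall s t : seq R,
     (forall p, p \in s -> irreducible_elt p) ->
     (forall p, p \in t -> irreducible_elt p) ->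
     associates (\prod_(p <- s) p) (\prod_(p <- t) p) ->
     exists t' : seq R, [/\ perm_eq t t', size s = size t' &
       forall i, (i < size s)%N -> associates s`_i t'`_i]).

(* ---- The n-regular tree with edges labelled by 'I_n ---- *)

(* The vertices are the words in 'I_n without two equal consecutive letters;
   an edge labelled k joins w and k :: w. *)
Definition Tn (n : nat) : Type :=
  {w : seq 'I_n | sorted (fun i j => i != j) w}.

Definition tree_edge (n : nat) (k : 'I_n) (t t' : Tn n) : bool :=
  (val t' == k :: val t) || (val t == k :: val t').

(* ---- The tropical semifield Trop(Z_1, ..., Z_n) ---- *)

(* Z_1^(a_1) ... Z_n^(a_n) is encoded by its exponent vector a, so that the
   multiplicative group of the semifield is the additive group 'rV[int]_n:
   products, inverses, powers and the unit are a + b, - a, a *~ m and 0. *)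
Notation trop n := 'rV[int]_n.

Definition trop_oplus (n : nat) (a b : trop n) : trop n :=
  \row_i Num.min (a 0 i) (b 0 i).

Definition tropZ (n : nat) (i : 'I_n) : trop n := delta_mx 0 i.

(* ---- The group ring KP and the ambient field F ---- *)

(* The group ring of Trop(Z_1, ..., Z_n) over K is the ring of Laurent
   polynomials in the Z_i, realised inside its fraction field K(Z). *)
Definition KZ (K : idomainType) (n : nat) := {fraction {mpoly K[n]}}.

Definition trop_mon (K : idomainType) (n : nat) (a : trop n) : KZ K n :=
  \prod_(i < n) tofrac ('X_i : {mpoly K[n]}) ^ a 0 i.

Definition in_KP (K : idomainType) (n : nat) (z : KZ K n) : Prop :=
  exists (p : {mpoly K[n]}) (a : trop n), z = tofrac p * trop_mon K a.

Definition ambient (K : idomainType) (n : nat) := {fraction {mpoly (KZ K n)[n]}}.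

Definition KZ_to_ambient (K : idomainType) (n : nat) (z : KZ K n)
  : ambient K n := tofrac (z%:MP : {mpoly (KZ K n)[n]}).

Definition trop_to_ambient (K : idomainType) (n : nat) (a : trop n)
  : ambient K n := KZ_to_ambient (trop_mon K a).

Definition free_generating_set (K : idomainType) (n : nat)
    (A : {ffun 'I_n -> ambient K n}) : Prop :=
  let KPpoly (p : {mpoly (KZ K n)[n]}) := forall m, in_KP p@_m in
  let ev (p : {mpoly (KZ K n)[n]}) := mmap (@KZ_to_ambient K n) A p in
  (forall p, KPpoly p -> ev p = 0 -> p = 0) /\
  (forall x : ambient K n, exists p q,
     [/\ KPpoly p, KPpoly q, ev q != 0 & x = ev p / ev q]).

(* ---- Seeds, mutation, seed patterns ---- *)

Definition skew_symmetrizable (n : nat) (B : 'M[int]_n) : Prop :=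
  exists2 d : 'rV[int]_n, (forall i, 0 < d 0 i)
    & (diag_mx d *m B)^T = - (diag_mx d *m B).

Record preseed (K : idomainType) (n : nat) := Preseed {
  seedB : 'M[int]_n;
  seedX : {ffun 'I_n -> trop n};
  seedA : {ffun 'I_n -> ambient K n} }.

Definition is_seed (K : idomainType) (n : nat) (S : preseed K n) : Prop :=
  skew_symmetrizable (seedB S) /\ free_generating_set (seedA S).

Definition exchange_binomial (K : idomainType) (n : nat) (S : preseed K n)
    (k : 'I_n) : ambient K n :=
  let: Preseed B X A := S in
  trop_to_ambient K (X k - trop_oplus 0 (X k))
    * \prod_(j < n | 0 < B j k) A j ^ B j k
  + trop_to_ambient K (- trop_oplus 0 (X k))
    * \prod_(j < n | B j k < 0) A j ^ (- B j k).

Definition mutation (K : idomainType) (n : nat) (k : 'I_n) (S : preseed K n)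
    : preseed K n :=
  let: Preseed B X A := S in
  Preseed
    (\matrix_(i, j) if (i == k) || (j == k) then - B i j
       else B i j + Num.sg (B i k) * Num.max (B i k * B k j) 0)
    [ffun i => if i == k then - X k
       else X i + X k *~ Num.max (B k i) 0
            + trop_oplus 0 (X k) *~ (- B k i)]
    [ffun i => if i == k then (A k)^-1 * exchange_binomial S k else A i].

Definition seed_pattern (K : idomainType) (n : nat)
    (Sig : Tn n -> preseed K n) : Prop :=
  (forall t, is_seed (Sig t)) /\
  (forall (k : 'I_n) (t t' : Tn n),
     tree_edge k t t' -> Sig t' = mutation k (Sig t)).

Definition principal_coefficients (K : idomainType) (n : nat)
    (Sig : Tn n -> preseed K n) (t0 : Tn n) : Prop :=
  forall i : 'I_n, seedX (Sig t0) i = tropZ i.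

Definition noninitial_cluster_variable (K : idomainType) (n : nat)
    (Sig : Tn n -> preseed K n) (t0 : Tn n) (x : ambient K n) : Prop :=
  (exists (t : Tn n) (k : 'I_n), x = seedA (Sig t) k) /\
  (forall i : 'I_n, x <> seedA (Sig t0) i).

(* ---- F-polynomials and g-vectors, with respect to the initial seed S ---- *)

Definition intZ_to_ambient (K : idomainType) (n : nat) (c : {mpoly int[n]})
    : ambient K n :=
  KZ_to_ambient (tofrac (map_mpoly (intr : int -> K) c)).

(* x is the element  p(A_1, ..., A_n) * A^a  of Z[Z][A_1^(+-1), ...], and f is
   its specialization at A_1 = ... = A_n = 1. *)
Definition is_specialization (K : idomainType) (n : nat) (S : preseed K n)
    (x : ambient K n) (f : {mpoly int[n]}) : Prop :=
  exists (p : {mpoly {mpoly int[n]}[n]}) (a : 'cV[int]_n),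
    x = mmap (@intZ_to_ambient K n) (seedA S) p
        * \prod_(i < n) seedA S i ^ a i 0
    /\ f = p.@[fun=> 1].

(* Unspecified if x has no Laurent expansion with coefficients in Z[Z]. *)
Definition Fpoly (K : idomainType) (n : nat) (S : preseed K n)
    (x : ambient K n) : {mpoly int[n]} :=
  epsilon (inhabits 0) (is_specialization S x).

Definition Xhat (K : idomainType) (n : nat) (S : preseed K n) (j : 'I_n)
    : ambient K n :=
  trop_to_ambient K (tropZ j) * \prod_(i < n) seedA S i ^ seedB S i j.

Definition is_gvector (K : idomainType) (n : nat) (S : preseed K n)
    (x : ambient K n) (g : 'cV[int]_n) : Prop :=
  x = (\prod_(i < n) seedA S i ^ g i 0)
      * mmap (intr : int -> ambient K n) (Xhat S) (Fpoly S x).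

(* Unspecified if x has no g-vector. *)
Definition gvector (K : idomainType) (n : nat) (S : preseed K n)
    (x : ambient K n) : 'cV[int]_n :=
  epsilon (inhabits 0) (is_gvector S x).

(* Main.v *)
(** Only characteristic 0 of K matters: all cluster variables live in Laurent
    rings over Z. For a seed t let L_t = Z[Z_i^(+-1), A_(i;t)^(+-1)].

    - If y lies in L_t and in the Laurent rings of all neighbours of t, then the
      same holds at every neighbour of t (the upper bounds of
      Berenstein-Fomin-Zelevinsky; principal coefficients make the columns of the
      extended exchange matrices independent, whence the needed coprimality).
    - A cluster variable x factors as A^g F(Xh), where F is positive at (1,..,1)
      and at the points with one Z_i = 0: these properties pass through
      subtraction-free exchange relations.
    - If F_M = F_N, then M = N A^h for some h. If h_k > 0, the exchange binomial
      P_k of t0, which is linear in Z_k and hence prime in L_(mu_k(t0)), divides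
      some cluster variable x in M, so x / A_k lies in all the L_t. In a seed t
      containing x the elements A_k and x / A_k are then monomials with
      non-negative exponents, so A_k is x up to sign and a monomial in Z, and
      positivity forces x = A_k. Hence h = 0. *)

Require Import Defs.
From HB Require Import structures.
From Stdlib Require Import Classical ClassicalEpsilon.
From mathcomp Require Import all_boot all_order all_algebra zify ring.
From mathcomp.multinomials Require Import mpoly.

Set Implicit Arguments.
Unset Strict Implicit.
Unset Printing Implicit Defensive.

Import Order.TTheory GRing.Theory Num.Theory.
Local Open Scope ring_scope.

(** * Laurent polynomials in one element over a subring *)

(** Every ring is a predicate on one fixed field and is built by adjoining one element at a time.
    Intersections, units, primality and coprimality thus become statements about the coefficients of
    univariate polynomials over a smaller ring, where transcendence of the adjoined element allows
    comparison. The factorization x = A^g F(Xh) has to be derived along the way. An exchange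
    relation divides by the old variable, so induction along the tree only gives x = A^g
    P(Xh)/Q(Xh). The Laurent phenomenon gives a second expression of x whose denominator is a
    monomial, and since no Z_i divides Q, both together force Q to divide P. A quotient of
    polynomials with positive coefficients may have negative ones, whereas signs of values pass to
    quotients. Hence positivity is tracked only as positivity of numerators and denominators at n +
    1 points: (1,..,1) detects a sign, and the point with Z_i = 0 detects a factor Z_i. *)

Ltac nonzero :=
  repeat (apply/andP; split); rewrite ?(mulf_neq0, invr_eq0, expf_neq0) //.

Definition hornerFE (F : fieldType) :=
  (@hornerD F, @hornerN F, @hornerC F, @hornerX F, @hornerXn F, @hornerZ F, @hornerM F).

Section Subring.
Variable F : fieldType.
Implicit Types (S T G : F -> Prop) (a b x y z : F) (p q : {poly F}).

Definition subringP S : Prop :=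
  [/\ S 1, forall x y, S x -> S y -> S (x - y)
         & forall x y, S x -> S y -> S (x * y)].

Section Closure.
Variables (S : F -> Prop) (hS : subringP S).

Lemma sub1 : S 1. Proof. by case: hS. Qed.
Lemma subB x y : S x -> S y -> S (x - y). Proof. by case: hS => _ h _; apply: h. Qed.
Lemma subM x y : S x -> S y -> S (x * y). Proof. by case: hS => _ _; apply. Qed.
Lemma sub0 : S 0. Proof. by rewrite -(subrr 1); apply: subB; apply: sub1. Qed.
Lemma subN x : S x -> S (- x).
Proof. by move=> h; rewrite -sub0r; apply: subB => //; apply: sub0. Qed.
Lemma subD x y : S x -> S y -> S (x + y).
Proof. by move=> hx hy; rewrite -(opprK y); apply: subB => //; apply: subN. Qed.
Lemma subX x k : S x -> S (x ^+ k).
Proof.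
move=> h; elim: k => [|k IH]; first by rewrite expr0; apply: sub1.
by rewrite exprS; apply: subM.
Qed.
Lemma sub_sum (I : Type) (r : seq I) (P : pred I) (f : I -> F) :
  (forall i, P i -> S (f i)) -> S (\sum_(i <- r | P i) f i).
Proof. by move=> h; apply: (big_ind S) => //; [apply: sub0 | apply: subD]. Qed.
Lemma sub_prod (I : Type) (r : seq I) (P : pred I) (f : I -> F) :
  (forall i, P i -> S (f i)) -> S (\prod_(i <- r | P i) f i).
Proof. by move=> h; apply: (big_ind S) => //; [apply: sub1 | apply: subM]. Qed.
Lemma subXz x (m : int) : S x -> S x^-1 -> S (x ^ m).
Proof.
move=> h h'; case: m => k; first by rewrite -exprnP; apply: subX.
by rewrite NegzE -exprnN -exprVn; apply: subX.
Qed.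

End Closure.

Definition polyIn S p : Prop := forall i, S p`_i.

Section PolyIn.
Variables (S : F -> Prop) (hS : subringP S).

Lemma polyIn_horner p x : polyIn S p -> S x -> S p.[x].
Proof.
move=> hp hx; rewrite horner_coef; apply: (sub_sum hS) => i _.
by apply: (subM hS) => //; apply: (subX hS).
Qed.
Lemma polyInC c : S c -> polyIn S c%:P.
Proof. by move=> h i; rewrite coefC; case: eqP => // _; apply: (sub0 hS). Qed.
Lemma polyInXn k : polyIn S 'X^k.
Proof. by move=> i; rewrite coefXn; case: eqP => _; [apply: (sub1 hS) | apply: (sub0 hS)]. Qed.
Lemma polyInX : polyIn S 'X. Proof. exact: (polyInXn 1). Qed.
Lemma polyInB p q : polyIn S p -> polyIn S q -> polyIn S (p - q).
Proof. by move=> hp hq i; rewrite coefB; apply: (subB hS). Qed.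
Lemma polyInD p q : polyIn S p -> polyIn S q -> polyIn S (p + q).
Proof. by move=> hp hq i; rewrite coefD; apply: (subD hS). Qed.
Lemma polyInM p q : polyIn S p -> polyIn S q -> polyIn S (p * q).
Proof. by move=> hp hq i; rewrite coefM; apply: (sub_sum hS) => j _; apply: (subM hS). Qed.
Lemma polyInZ c p : S c -> polyIn S p -> polyIn S (c *: p).
Proof. by move=> hc hp i; rewrite coefZ; apply: (subM hS). Qed.
Lemma polyIn_sum (I : Type) (r : seq I) (P : pred I) (f : I -> {poly F}) :
  (forall i, P i -> polyIn S (f i)) -> polyIn S (\sum_(i <- r | P i) f i).
Proof.
move=> h; apply: (big_ind (polyIn S)) => //; last exact: polyInD.
by rewrite -polyC0; apply: polyInC; apply: (sub0 hS).
Qed.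

End PolyIn.

Lemma polyIn_sub S T p : (forall x, S x -> T x) -> polyIn S p -> polyIn T p.
Proof. by move=> h hp i; apply: h. Qed.

Definition laur S a y : Prop :=
  exists p k, polyIn S p /\ y = p.[a] / a ^+ k.

Definition adj S a y : Prop := exists2 p, polyIn S p & y = p.[a].

Definition transc S a : Prop := forall p, polyIn S p -> p.[a] = 0 -> p = 0.

Section Laurent.
Variables (S : F -> Prop) (hS : subringP S) (a : F) (a0 : a != 0).

Lemma laur_in x : S x -> laur S a x.
Proof.
move=> h; exists x%:P, 0%N; split; first exact: (polyInC hS).
by rewrite hornerC expr0 divr1.
Qed.

Lemma laur_gen : laur S a a.
Proof.
exists 'X, 0%N; split; first exact: (polyInX hS).
by rewrite hornerX expr0 divr1.
Qed.

Lemma laur_inv : laur S a a^-1.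
Proof.
exists 1, 1%N; split; first by rewrite -polyC1; apply: (polyInC hS); apply: (sub1 hS).
by rewrite -polyC1 hornerC expr1 mul1r.
Qed.

Lemma laur_subring : subringP (laur S a).
Proof.
split; first by apply: laur_in; apply: (sub1 hS).
- move=> _ _ [p [k [hp ->]]] [q [l [hq ->]]].
  exists (p * 'X^l - q * 'X^k), (k + l)%N; split.
    by apply: (polyInB hS); apply: (polyInM hS) => //; apply: (polyInXn hS).
  rewrite !hornerFE exprD; field.
  by rewrite !expf_neq0.
- move=> _ _ [p [k [hp ->]]] [q [l [hq ->]]].
  exists (p * q), (k + l)%N; split; first exact: (polyInM hS).
  rewrite !hornerFE exprD; field.
  by rewrite !expf_neq0.
Qed.

Lemma adj_in x : S x -> adj S a x.
Proof. by move=> h; exists x%:P; [apply: (polyInC hS) | rewrite hornerC]. Qed.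

Lemma adj_gen : adj S a a.
Proof. by exists 'X; [apply: (polyInX hS) | rewrite hornerX]. Qed.

Lemma adj_subring : subringP (adj S a).
Proof.
split; first by apply: adj_in; apply: (sub1 hS).
- move=> _ _ [p hp ->] [q hq ->]; exists (p - q); first exact: (polyInB hS).
  by rewrite !hornerFE.
- move=> _ _ [p hp ->] [q hq ->]; exists (p * q); first exact: (polyInM hS).
  by rewrite !hornerFE.
Qed.

End Laurent.

(** The universal property of S[a^(+-1)]: inclusions between Laurent rings are reduced to generators
    by it. *)
Lemma laur_min S T a : subringP T -> (forall x, S x -> T x) -> T a -> T a^-1 ->
  forall y, laur S a y -> T y.
Proof.
move=> hT hST ha ha' _ [p [k [hp ->]]]; apply: (subM hT).
  by apply: (polyIn_horner hT) => //; apply: (polyIn_sub hST).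
by rewrite -exprVn; apply: (subX hT).
Qed.

Lemma adj_min S T a : subringP T -> (forall x, S x -> T x) -> T a ->
  forall y, adj S a y -> T y.
Proof.
move=> hT hST ha _ [p hp ->].
by apply: (polyIn_horner hT) => //; apply: (polyIn_sub hST).
Qed.

Lemma laur_mono S T a : subringP T -> a != 0 -> (forall x, S x -> T x) ->
  forall y, laur S a y -> laur T a y.
Proof.
move=> hT a0 hST y; apply: laur_min.
- exact: laur_subring.
- by move=> x /hST; apply: laur_in.
- exact: laur_gen.
- exact: laur_inv.
Qed.

Lemma laur_adj S a : subringP S -> a != 0 -> forall y, adj S a y -> laur S a y.
Proof.
move=> hS a0; apply: adj_min; first exact: laur_subring.
- by move=> x; apply: laur_in.
- exact: laur_gen.
Qed.

Lemma laur_swap S a b : subringP S -> a != 0 -> b != 0 ->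
  forall y, laur (laur S a) b y -> laur (laur S b) a y.
Proof.
move=> hS a0 b0.
have hb := laur_subring hS b0; have hab := laur_subring hb a0.
apply: laur_min => //.
- apply: laur_mono => // x; exact: laur_in.
- by apply: laur_in => //; apply: laur_gen.
- by apply: laur_in => //; apply: laur_inv.
Qed.

Lemma transc_sub S T a : (forall x, S x -> T x) -> transc T a -> transc S a.
Proof. by move=> h hT p hp; apply: hT; apply: polyIn_sub hp. Qed.

Lemma transc_inj S a p q : subringP S -> transc S a ->
  polyIn S p -> polyIn S q -> p.[a] = q.[a] -> p = q.
Proof.
move=> hS ha hp hq e; apply/eqP; rewrite -subr_eq0; apply/eqP; apply: ha.
  exact: (polyInB hS).
by rewrite !hornerFE e subrr.
Qed.

(* With S0 = S and c = 1 this says that S[b^(+-1)] and S[(Q/b)^(+-1)] intersect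
   in S[b, Q/b]. *)
Lemma laur_inter S0 S b b' Q c x :
  subringP S0 -> subringP S -> (forall x, S0 x -> S x) ->
  transc S b -> b != 0 -> S Q -> Q != 0 -> b' = Q / b -> S c ->
  (forall z l, S0 z -> (exists2 w, S w & c * z = Q ^+ l * w) ->
     exists2 w, S0 w & z = Q ^+ l * w) ->
  laur S0 b x -> laur S b' (c * x) ->
  exists u v, [/\ polyIn S0 u, polyIn S0 v & x = u.[b] + v.[b']].
Proof.
move=> hS0 hS hsub hb b0 hQ Q0 -> hc hdiv [f [N [hf ->]]] [g [M [hg e]]].
pose d := size g.
have Qb0 : Q / b != 0 by rewrite mulf_neq0 ?invr_eq0.
(* Multiplying c x = g(Q/b) / (Q/b)^M by Q^M b^(d+N) leaves a polynomial in b on both sides. *)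
have key : (c * Q ^+ M) *: (f * 'X^d)
    = \sum_(i < d) (g`_i * Q ^+ i) *: 'X^(d - i + M + N).
  apply: (transc_inj hS hb).
  - apply: (polyInZ hS); first by apply: (subM hS) => //; apply: (subX hS).
    by apply: (polyInM hS); [apply: polyIn_sub hf | apply: (polyInXn hS)].
  - apply: (polyIn_sum hS) => i _; apply: (polyInZ hS); last exact: (polyInXn hS).
    by apply: (subM hS) => //; apply: (subX hS).
  - have -> : ((c * Q ^+ M) *: (f * 'X^d)).[b]
       = (c * (f.[b] / b ^+ N)) * (Q ^+ M * b ^+ d * b ^+ N).
      rewrite !hornerFE; field; by rewrite expf_neq0.
    rewrite e horner_coef -/d horner_sum mulrAC -mulrA mulr_suml.
    apply: eq_bigr => i _; rewrite !hornerFE.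
    rewrite !expr_div_n !exprD.
    have -> : b ^+ d = b ^+ (d - i) * b ^+ i by rewrite -exprD subnK // ltnW.
    by field; rewrite !expf_neq0 // mulf_neq0 // ?expf_neq0.
(* The coefficient of b^(m+d) shows that Q^(N-m) divides c f_m. By [hdiv] it then divides f_m, so
   the polar term f_m b^(m-N) is a multiple of (Q/b)^(N-m). *)
have hcoef m : (m < N)%N -> c * f`_m = Q ^+ (N - m) * g`_(M + N - m).
  move=> hm; have := congr1 (fun p : {poly F} => p`_(m + d)) key.
  rewrite coefZ coefMXn coef_sum ltnNge leq_addl /= addnK => e'.
  have QM0 : Q ^+ M != 0 by rewrite expf_neq0.
  apply: (mulfI QM0); rewrite mulrA [Q ^+ M * c]mulrC e'.
  have [lt|ge] := ltnP (M + N - m) d.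
    rewrite (bigD1 (Ordinal lt)) //= big1 => [|i ni].
      rewrite coefZ coefXn.
      have -> : (m + d == d - (M + N - m) + M + N)%N by apply/eqP; lia.
      rewrite mulr1 addr0 mulrA -exprD mulrC; congr (Q ^+ _ * _); lia.
    rewrite coefZ coefXn.
    have -> : (m + d == d - i + M + N)%N = false.
      apply/eqP => h; case/eqP: ni; apply: val_inj => /=.
      by have := ltn_ord i; lia.
    by rewrite mulr0.
  rewrite [g`_(M + N - m)]nth_default // !mulr0 big1 // => i _.
  rewrite coefZ coefXn.
  have -> : (m + d == d - i + M + N)%N = false.
    by apply/eqP => h; have := ltn_ord i; lia.
  by rewrite mulr0.
have ex (m : 'I_N) : exists w, S0 w /\ f`_m = Q ^+ (N - m) * w.
  have [|w hw e'] := hdiv f`_m (N - m)%N (hf m); last by exists w.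
  by exists g`_(M + N - m); [apply: hg | apply: hcoef].
have [h hh] := fin_all_exists ex.
exists (drop_poly N f), (\sum_(m < N) h m *: 'X^(N - m)); split.
- by move=> i; rewrite coef_drop_poly.
- apply: (polyIn_sum hS0) => m _; apply: (polyInZ hS0); first by case: (hh m).
  exact: (polyInXn hS0).
- rewrite -{1}(poly_take_drop N f) !hornerFE mulrDl mulfK ?expf_neq0 // addrC.
  congr (_ + _); rewrite horner_poly horner_sum mulr_suml; apply: eq_bigr => m _.
  rewrite !hornerFE; case: (hh m) => _ ->; rewrite expr_div_n.
  have -> : b ^+ N = b ^+ (N - m) * b ^+ m by rewrite -exprD subnK // ltnW.
  by field; rewrite !expf_neq0.
Qed.

(** The numerators of x and y multiply to a power of 'X, whose only factors over a field are
    monomials; their leading coefficients lie in S and are inverse to each other. *)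
Lemma laur_unit S a x y : subringP S -> transc S a -> a != 0 ->
  laur S a x -> laur S a y -> x * y = 1 ->
  exists s s' m, [/\ S s, S s', s * s' = 1 & x = s * a ^ (m : int)].
Proof.
move=> hS ha a0 [p [k [hp ->]]] [q [l [hq ->]]] e.
have epq : p * q = 'X^(k + l).
  apply: (transc_inj hS ha); [exact: (polyInM hS) | exact: (polyInXn hS)|].
  have : p.[a] * q.[a] = a ^+ k * a ^+ l * (p.[a] / a ^+ k * (q.[a] / a ^+ l)).
    by field; rewrite !expf_neq0.
  by rewrite e !hornerFE exprD mulr1.
have nzpq : p * q != 0 by rewrite epq -size_poly_eq0 size_polyXn.
have [p0 q0] : p != 0 /\ q != 0.
  by split; apply: contraNneq nzpq => ->; rewrite ?mul0r ?mulr0.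
have mono (r1 r2 : {poly F}) N : r1 * r2 = 'X^N -> exists2 m, r1 = lead_coef r1 *: 'X^m & (m <= N)%N.
  elim: N r1 r2 => [|N IH] r1 r2 er.
    have : (size r1).-1 = 0%N.
      have nz1 : r1 != 0 by apply: contra_eq_neq er => ->; rewrite mul0r eq_sym oner_eq0.
      have nz2 : r2 != 0 by apply: contra_eq_neq er => ->; rewrite mulr0 eq_sym oner_eq0.
      have : size (r1 * r2) = 1%N by rewrite er size_polyXn.
      rewrite size_mul //.
      have s1 : (0 < size r1)%N by rewrite size_poly_gt0.
      have s2 : (0 < size r2)%N by rewrite size_poly_gt0.
      move: s1 s2; case: (size r1) => // k1; case: (size r2) => // k2 _ _ /=.
      by rewrite addnS /= => /eqP; rewrite eqSS addn_eq0 => /andP[/eqP].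
    exists 0%N => //; rewrite expr0 alg_polyC lead_coefE H.
    by apply: size1_polyC; lia.
  have : root (r1 * r2) 0 by rewrite er rootE !hornerFE exprS mul0r.
  rewrite rootM => /orP[] /factor_theorem [r hr]; rewrite subr0 in hr.
    have er' : r * r2 = 'X^N.
      apply: (@mulIf _ 'X); first by rewrite polyX_eq0.
      by rewrite -exprSr -er hr mulrAC.
    have [m hm le] := IH _ _ er'; exists m.+1 => //.
    rewrite hr lead_coefMX {1}hm.
    by rewrite -scalerAl -exprSr.
  have er' : r1 * r = 'X^N.
    apply: (@mulIf _ 'X); first by rewrite polyX_eq0.
    by rewrite -exprSr -er hr mulrA.
  by have [m hm le] := IH _ _ er'; exists m => //; apply: leqW.
have [m hm lem] := mono p q _ epq.
have [m' hm' _] := mono q p _ (etrans (mulrC _ _) epq).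
exists (lead_coef p), (lead_coef q), (m%:Z - k%:Z); split.
- exact: hp.
- exact: hq.
- have := congr1 lead_coef epq; rewrite lead_coefM lead_coefXn; done.
- rewrite {1}hm !hornerFE expfzDr // exprnN.
  by rewrite mulrA.
Qed.

(** Since z - th is monic and linear, it divides an element as soon as the numerator vanishes at th,
    and a product vanishes there only if a factor does. As th != 0, the denominators z^k do not
    vanish there. *)
Lemma laur_prime S z th xs y : subringP S -> transc S z -> z != 0 ->
  S th -> th != 0 -> (forall x, x \in xs -> laur S z x) -> laur S z y ->
  \prod_(x <- xs) x = (z - th) * y ->
  exists2 x, x \in xs & laur S z (x / (z - th)).
Proof.
move=> hS hz z0 hth th0 hxs hy e.
have zth : z - th != 0.
  apply/eqP => h; suff /eqP : 'X - th%:P = 0 by rewrite polyXsubC_eq0.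
  apply: hz; last by rewrite !hornerFE.
  by apply: (polyInB hS); [apply: (polyInX hS) | apply: (polyInC hS)].
have fact (p : {poly F}) : polyIn S p ->
    exists2 q, polyIn S q & p = q * ('X - th%:P) + (p.[th])%:P.
  elim/poly_ind: p => [|p c IH] hp.
    by exists 0; rewrite ?mul0r ?horner0 ?addr0.
  have hp' : polyIn S p by move=> i; have := hp i.+1; rewrite coefD coefMX coefC /= addr0.
  have [q hq eq] := IH hp'.
  exists (q * 'X + (p.[th])%:P).
    apply: (polyInD hS); first by apply: (polyInM hS) => //; apply: (polyInX hS).
    by apply: (polyInC hS); apply: (polyIn_horner hS).
  rewrite {1}eq !hornerFE !rmorphD !rmorphM /=; ring.
pose zero x := exists p k, [/\ polyIn S p, x = p.[z] / z ^+ k & p.[th] = 0].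
have zeroP x : laur S z x -> zero x \/ exists p k, [/\ polyIn S p, x = p.[z] / z ^+ k & p.[th] != 0].
  move=> [p [k [hp ->]]]; case: (eqVneq p.[th] 0) => h; [left | right]; by exists p, k.
have [[x hx zx]|hno] := classic (exists2 x, x \in xs & zero x).
  exists x => //; have [p [k [hp -> ep]]] := zx.
  have [q hq eq] := fact p hp.
  exists q, k; split => //.
  rewrite {1}eq ep !hornerFE; field.
  by rewrite expf_neq0.
exfalso.
have [p [k [hp ep np]]] : exists p k, [/\ polyIn S p, \prod_(x <- xs) x = p.[z] / z ^+ k & p.[th] != 0].
  elim: xs hxs hno {e} => [|x xs IH] hxs hno.
    exists 1%:P, 0%N; rewrite big_nil !hornerC expr0 divr1 oner_eq0; split=> //.
    by apply: (polyInC hS); apply: (sub1 hS).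
  have [|[w hw zw]|p [k [hp ep np]]] := IH.
  - by move=> w hw; apply: hxs; rewrite inE hw orbT.
  - by apply: hno; exists w => //; rewrite inE hw orbT.
  have [h|[q [l [hq eq nq]]]] := zeroP x (hxs x (mem_head _ _)).
    by case: hno; exists x => //; apply: mem_head.
  exists (q * p), (l + k)%N; rewrite big_cons ep {1}eq; split; first exact: (polyInM hS).
    by rewrite !hornerFE exprD; field; rewrite !expf_neq0.
  by rewrite hornerM mulf_neq0.
move: hy e => [q [l [hq ->]]]; rewrite ep => e.
have epq : p * 'X^l = ('X - th%:P) * q * 'X^k.
  apply: (transc_inj hS hz).
  - by apply: (polyInM hS) => //; apply: (polyInXn hS).
  - apply: (polyInM hS); last exact: (polyInXn hS).
    apply: (polyInM hS) => //.
    by apply: (polyInB hS); [apply: (polyInX hS) | apply: (polyInC hS)].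
  - have -> : (p * 'X^l).[z] = p.[z] / z ^+ k * (z ^+ k * z ^+ l).
      by rewrite !hornerFE; field; rewrite expf_neq0.
    by rewrite e !hornerFE; field; rewrite expf_neq0.
have := congr1 (fun r : {poly F} => r.[th]) epq.
rewrite !hornerFE subrr !mul0r => /eqP.
by rewrite mulf_eq0 (negbTE np) expf_eq0 (negbTE th0) andbF.
Qed.

End Subring.

(** * Crossing two mutations *)

Section Star.
Variable F : fieldType.
Implicit Types (S R : F -> Prop).

(** The case b_ij = 0, where P and Q are free of a and b. The first two rings give y = p(a) + q(P/a)
    with coefficients in R[b^(+-1)]. Comparison with the third, power of a by power of a, puts p_k,
    P^i q_i (for k, i > 0) and p_0 + q_0 into R[(Q/b)^(+-1)]; coprimality of P and Q then removes
    the factor P^i. *)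
Lemma star_indep R (a b P Q e y : F) :
  subringP R -> a != 0 -> b != 0 ->
  transc (laur R b) a -> transc (laur R a) b ->
  R P -> P != 0 -> R Q -> Q != 0 -> R e -> R e^-1 -> e != 0 ->
  (forall z m l, R z -> (exists2 w, R w & P ^+ m * z = Q ^+ l * w) ->
     exists2 w, R w & z = Q ^+ l * w) ->
  laur (laur R b) a y -> laur (laur R b) (P / a) y -> laur (laur R a) (Q / b) y ->
  laur (laur R (P / a)) (e * (Q / b)) y.
Proof.
move=> hR a0 b0 ta tb hP P0 hQ Q0 he he' e0 cop hy hya hyb.
have hRb := laur_subring hR b0; have hRa := laur_subring hR a0.
have a'0 : P / a != 0 by rewrite mulf_neq0 ?invr_eq0.
have b'0 : Q / b != 0 by rewrite mulf_neq0 ?invr_eq0.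
have hRb' := laur_subring hR b'0.
have tb0 : transc R b by apply: transc_sub tb => x; apply: laur_in.
(* The fraction field of R[b^(+-1)] contains R[(Q/b)^(+-1)] too, and a stays transcendental over it;
   there the two expansions in a can be compared. *)
pose Fr x := exists u v, [/\ laur R b u, laur R b v, v != 0 & x = u / v].
have hFr : subringP Fr.
  split; first by exists 1, 1; rewrite divr1 oner_eq0; split=> //; apply: (sub1 hRb).
  - move=> _ _ [u [v [hu hv v0 ->]]] [u' [v' [hu' hv' v0' ->]]].
    exists (u * v' - u' * v), (v * v'); rewrite mulf_neq0 //; split=> //.
    + by apply: (subB hRb); apply: (subM hRb).
    + exact: (subM hRb).
    + by field; nonzero.
  - move=> _ _ [u [v [hu hv v0 ->]]] [u' [v' [hu' hv' v0' ->]]].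
    exists (u * u'), (v * v'); rewrite mulf_neq0 //; split=> //.
    + exact: (subM hRb).
    + exact: (subM hRb).
    + by field; nonzero.
have bFr x : laur R b x -> Fr x.
  by move=> h; exists x, 1; rewrite divr1 oner_eq0; split=> //; apply: (sub1 hRb).
have b'Fr x : laur R (Q / b) x -> Fr x.
  apply: laur_min => //.
  - by move=> z h; apply: bFr; apply: laur_in.
  - apply: bFr; apply: (subM hRb); [exact: laur_in | exact: laur_inv].
  - exists b, Q; rewrite invf_div; split=> //; [exact: laur_gen | exact: laur_in].
have taFr : transc Fr a.
  move=> p hp ep.
  have ex (i : 'I_(size p)) : exists uv : F * F,
      [/\ laur R b uv.1, laur R b uv.2, uv.2 != 0 & p`_i = uv.1 / uv.2].
    by have [u [v h]] := hp i; exists (u, v).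
  have [f hf] := fin_all_exists ex.
  pose D := \prod_i (f i).2.
  have D0 : D != 0 by apply/prodf_neq0 => i _; case: (hf i).
  have : D *: p = 0.
    apply: ta; last by rewrite hornerZ ep mulr0.
    move=> k; rewrite coefZ.
    have [lt|ge] := ltnP k (size p); last by rewrite nth_default // mulr0; apply: (sub0 hRb).
    rewrite /D (bigD1 (Ordinal lt)) //=; have [h1 h2 h3 ->] := hf (Ordinal lt).
    rewrite mulrAC mulrC [_ * (_ / _)]mulrC divfK //.
    by rewrite mulrC; apply: (subM hRb) => //; apply: (sub_prod hRb) => i _; case: (hf i).
  by move/eqP; rewrite scaler_eq0 (negbTE D0) => /eqP.
have [p [q [hp hq ey]]] : exists p q, [/\ polyIn (laur R b) p, polyIn (laur R b) q &
    y = p.[a] + q.[P / a]].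
  apply: (@laur_inter _ (laur R b) (laur R b) a _ P 1) => //.
  - exact: laur_in.
  - exact: (sub1 hRb).
  - by move=> z l hz [w hw]; rewrite mul1r => ->; exists w.
  - by rewrite mul1r.
have [r [N [hr er]]] := laur_swap hR a0 b'0 hyb.
pose d := size q.
have epol : (p * 'X^d + \sum_(i < d) (q`_i * P ^+ i) *: 'X^(d - i)) * 'X^N = r * 'X^d.
  apply: (transc_inj hFr taFr).
  - apply: (polyInM hFr); last exact: (polyInXn hFr).
    apply: (polyInD hFr).
      by apply: (polyInM hFr); [apply: polyIn_sub hp => x; apply: bFr | apply: (polyInXn hFr)].
    apply: (polyIn_sum hFr) => i _; apply: (polyInZ hFr); last exact: (polyInXn hFr).
    apply: (subM hFr); first exact: bFr.
    by apply: (subX hFr); apply: bFr; apply: laur_in.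
  - by apply: (polyInM hFr); [apply: polyIn_sub hr | apply: (polyInXn hFr)].
  - have -> : (r * 'X^d).[a] = r.[a] / a ^+ N * a ^+ N * a ^+ d.
      by rewrite !hornerFE; field; rewrite expf_neq0.
    rewrite -er ey !hornerFE horner_sum [q.[_]]horner_coef -/d.
    rewrite -!mulrA [a ^+ N * _]mulrC !mulrA; congr (_ * _).
    rewrite mulrDl; congr (_ + _); rewrite mulr_suml; apply: eq_bigr => i _.
    rewrite !hornerFE expr_div_n.
    have -> : a ^+ d = a ^+ (d - i) * a ^+ i by rewrite -exprD subnK // ltnW.
    by field; nonzero.
have coe k : laur R (Q / b) ((p * 'X^d + \sum_(i < d) (q`_i * P ^+ i) *: 'X^(d - i))`_k).
  have := congr1 (fun p : {poly F} => p`_(k + N)) epol.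
  rewrite coefMXn ltnNge leq_addl /= addnK => ->.
  by rewrite coefMXn; case: ifP => _; [apply: (sub0 hRb') | apply: hr].
have hq0 i : (0 < i < d)%N -> laur R (Q / b) (P ^+ i * q`_i).
  move=> /andP[i0 lt]; have := coe (d - i)%N; rewrite coefD coefMXn coef_sum.
  rewrite ifT; last by lia.
  rewrite add0r (bigD1 (Ordinal lt)) //= big1 => [|j nj].
    by rewrite coefZ coefXn eqxx mulr1 addr0 [q`_i * _]mulrC.
  rewrite coefZ coefXn; case: eqP => [h|]; last by rewrite mulr0.
  case/eqP: nj; apply: val_inj => /=; have := ltn_ord j; lia.
have hq1 i : (0 < i)%N -> laur R (Q / b) (q`_i).
  move=> i0; have [lt|ge] := ltnP i d; last by rewrite nth_default //; apply: (sub0 hRb').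
  have [u [v [hu hv ->]]] : exists u v, [/\ polyIn R u, polyIn R v & q`_i = u.[b] + v.[Q / b]].
    apply: (@laur_inter _ R R b _ Q (P ^+ i)) => //.
    - exact: (subX hR).
    - by move=> z l hz h; apply: (cop z i l).
    - by apply: hq0; rewrite i0 lt.
  have gb' : laur R (Q / b) (Q / b) by apply: laur_gen.
  apply: (subD hRb').
    apply: (polyIn_horner hRb'); first by apply: polyIn_sub hu => x; apply: laur_in.
    rewrite [X in laur _ _ X](_ : b = Q * (Q / b)^-1); last by field; nonzero.
    by apply: (subM hRb'); [apply: laur_in | apply: laur_inv].
  by apply: (polyIn_horner hRb') => //; apply: polyIn_sub hv => x; apply: laur_in.
have hp1 k : laur R (Q / b) (p`_k.+1).
  have := coe (d + k.+1)%N; rewrite coefD coefMXn coef_sum ltnNge leq_addr /= addKn.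
  rewrite big1 ?addr0 // => j _; rewrite coefZ coefXn; case: eqP => [h|]; last by rewrite mulr0.
  by have := ltn_ord j; lia.
have h00 : laur R (Q / b) (p`_0 + q`_0).
  have := coe d; rewrite coefD coefMXn coef_sum ltnn subnn.
  case: (posnP d) => [d0|dp].
    have -> : q`_0 = 0 by rewrite nth_default // -/d d0.
    by rewrite big1 // => j _; have := leq_trans (ltn_ord j) (eq_leq d0).
  rewrite (bigD1 (Ordinal dp)) //= big1 => [|j nj].
    by rewrite coefZ coefXn subn0 eqxx expr0 !mulr1 addr0.
  rewrite coefZ coefXn; case: eqP => [h|]; last by rewrite mulr0.
  case/eqP: nj; apply: val_inj => /=; have := ltn_ord j; lia.
have hRa' := laur_subring hR a'0.
have eb'0 : e * (Q / b) != 0 by rewrite mulf_neq0.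
set D := laur _ _; have hD : subringP D by apply: laur_subring.
have RD x : R x -> D x by move=> h; apply: laur_in => //; apply: laur_in.
have b'D x : laur R (Q / b) x -> D x.
  apply: laur_min => //.
  - have -> : Q / b = e^-1 * (e * (Q / b)) by rewrite mulKf.
    by apply: (subM hD); [apply: RD | apply: laur_gen].
  - have -> : (Q / b)^-1 = e * (e * (Q / b))^-1 by field; nonzero.
    by apply: (subM hD); [apply: RD | apply: laur_inv].
have a'D : D (P / a) by apply: laur_in => //; apply: laur_gen.
have aD : D a.
  have -> : a = P * (P / a)^-1 by field; nonzero.
  by apply: (subM hD); [apply: RD | apply: laur_in => //; apply: laur_inv].
rewrite ey.
have split0 (f : {poly F}) x : f.[x] = f`_0 + x * (drop_poly 1 f).[x].
  rewrite -{1}(poly_take_drop 1 f) hornerD hornerM hornerXn expr1 [_ * x]mulrC; congr (_ + _).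
  by rewrite horner_poly big_ord1 expr0 mulr1.
rewrite (split0 p) (split0 q) addrACA; apply: (subD hD); first exact: b'D.
apply: (subD hD); apply: (subM hD) => //; apply: (polyIn_horner hD) => // i;
  rewrite coef_drop_poly addn1; apply: b'D => //.
exact: hq1.
Qed.

(** The binomial has the invertible constant term p1, so multiplication by it cannot cancel a pole
    at b = 0. *)
Lemma adj_of_laur R b p1 p2 k h m :
  subringP R -> transc R b -> b != 0 -> R p1 -> R p1^-1 -> p1 != 0 -> R p2 ->
  laur R b h -> adj R b (h * (p1 + p2 * b ^+ k.+1) ^+ m) -> adj R b h.
Proof.
move=> hR tb b0 hp1 hp1' p10 hp2; elim: m h => [|m IH] h hh; first by rewrite expr0 mulr1.
rewrite exprS mulrA => H.
have hRb := laur_subring hR b0.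
have : adj R b (h * (p1 + p2 * b ^+ k.+1)).
  apply: IH => //; apply: (subM hRb) => //; apply: (subD hRb); first exact: laur_in.
  by apply: (subM hRb); [apply: laur_in | apply: (subX hRb); apply: laur_gen].
move=> {H} [g hg eg]; move: hh => [f [N [hf ef]]].
pose P := p1%:P + p2 *: 'X^(k.+1).
have hP : polyIn R P.
  by apply: (polyInD hR); [apply: (polyInC hR) | apply: (polyInZ hR) => //; apply: (polyInXn hR)].
have epol : f * P = g * 'X^N.
  apply: (transc_inj hR tb); [exact: (polyInM hR)| by apply: (polyInM hR) => //; apply: (polyInXn hR)|].
  rewrite /P !hornerFE -eg ef; field; nonzero.
have fz i : (i < N)%N -> f`_i = 0.
  elim/ltn_ind: i => i IHi lt.
  have := congr1 (fun p : {poly F} => p`_i) epol.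
  rewrite coefMXn lt /P mulrDr coefD -scalerAr coefZ coefMXn.
  have -> : p2 * (if (i < k.+1)%N then 0 else f`_(i - k.+1)) = 0.
    by case: ltnP => h'; [rewrite mulr0 | rewrite IHi ?mulr0 //; lia].
  rewrite addr0 coefMC => /eqP; rewrite mulf_eq0 (negbTE p10) orbF => /eqP //.
exists (drop_poly N f); first by move=> i; rewrite coef_drop_poly.
rewrite ef -{1}(poly_take_drop N f) !hornerFE.
have -> : take_poly N f = 0.
  by apply/polyP => i; rewrite coef_take_poly coef0; case: ifP => // /fz.
by rewrite horner0 add0r mulfK // expf_neq0.
Qed.

(* Following Berenstein-Fomin-Zelevinsky: for b_ij <> 0 the intersection of the
   three Laurent rings is the ring C = R[a, P/a, b, Q/b], which is visibly
   contained in the fourth one. This rests on J = C0 + b^N J for all N, where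
   J = R[a^(+-1), b] and C0 = R[a, P/a, b]. *)
Lemma star_dep R (a b P Q p1 p2 q1 q2 e b2 y : F) k l :
  subringP R -> a != 0 -> b != 0 ->
  transc (laur R b) a -> transc (laur R a) b ->
  R p1 -> R p1^-1 -> p1 != 0 -> R p2 -> R q1 -> R q2 ->
  P = p1 + p2 * b ^+ k.+1 -> P != 0 -> Q = q1 + q2 * a ^+ l.+1 -> Q != 0 ->
  b2 != 0 -> laur R (P / a) e -> laur R (P / a) (b * b2) ->
  e * (b * b2) = q1 + q2 * (p1 / (P / a)) ^+ l.+1 ->
  laur (laur R b) a y -> laur (laur R b) (P / a) y -> laur (laur R a) (Q / b) y ->
  laur (laur R (P / a)) b2 y.
Proof.
move=> hR a0 b0 ta tb hp1 hp1' p10 hp2 hq1 hq2 eP P0 eQ Q0 b20 he hbb2 ee hy hya hyb.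
have hRb := laur_subring hR b0; have hRa := laur_subring hR a0.
have a'0 : P / a != 0 by rewrite mulf_neq0 ?invr_eq0.
have b'0 : Q / b != 0 by rewrite mulf_neq0 ?invr_eq0.
have hRa' := laur_subring hR a'0.
have hRb0 := adj_subring hR b.
have tb0 : transc R b by apply: transc_sub tb => x; apply: laur_in.
have hQa : laur R a Q.
  rewrite eQ; apply: (subD hRa); first exact: laur_in.
  by apply: (subM hRa); [apply: laur_in | apply: (subX hRa); apply: laur_gen].
have hPb0 : adj R b P.
  rewrite eP; apply: (subD hRb0); first exact: adj_in.
  by apply: (subM hRb0); [apply: adj_in | apply: (subX hRb0); apply: adj_gen].
have hPb : laur R b P by apply: laur_adj.
set D := laur _ _; have hD : subringP D by apply: laur_subring.
have a'D x : laur R (P / a) x -> D x by apply: laur_in.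
have RD x : R x -> D x by move=> h; apply: a'D; apply: laur_in.
have bD : D b.
  have -> : b = b * b2 * b2^-1 by field; nonzero.
  by apply: (subM hD); [apply: a'D | apply: laur_inv].
have PD : D P by move: hPb0; apply: adj_min.
have a'iD : D (P / a)^-1 by apply: a'D; apply: laur_inv.
have aD : D a.
  have -> : a = P * (P / a)^-1 by field; nonzero.
  exact: (subM hD).
(* P is congruent to p1 modulo b, hence so are their powers, with a quotient w in R[b]. *)
have [w hw ew] : exists2 w, adj R b w & P ^+ l.+1 = p1 ^+ l.+1 + b * w.
  have R1 x : R x -> adj R b x by apply: adj_in.
  elim: {hq2 eQ ee} l => [|l [w hw ew]].
    exists (p2 * b ^+ k); last by rewrite !expr1 eP exprS; ring.
    by apply: (subM hRb0); [apply: R1 | apply: (subX hRb0); apply: adj_gen].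
  exists (p1 ^+ l.+1 * p2 * b ^+ k + w * P).
    apply: (subD hRb0); last by apply: (subM hRb0).
    apply: (subM hRb0); last by apply: (subX hRb0); apply: adj_gen.
    by apply: R1; apply: (subM hR) => //; apply: (subX hR).
  rewrite [LHS]exprSr ew [p1 ^+ l.+2]exprSr {1}eP mulrDl; rewrite {1}[b ^+ k.+1]exprS.
  rewrite [in RHS]eP; ring.
(* Put a' = P / a. Then Q = q1 + q2 (P/a')^(l+1), while e b b2 = q1 + q2 (p1/a')^(l+1). The
   difference is divisible by b, and the quotient is q2 w / a'^(l+1). *)
have b'D : D (Q / b).
  have -> : Q / b = e * b2 + q2 * w * ((P / a)^-1) ^+ l.+1.
    have eb2 : e * b2 = (q1 + q2 * (p1 / (P / a)) ^+ l.+1) / b by rewrite -ee; field.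
    rewrite eb2 eQ.
    have ebw : b * w = P ^+ l.+1 - p1 ^+ l.+1 by rewrite ew; ring.
    apply: (mulIf b0); rewrite [RHS]mulrDl !divfK //.
    have -> : q2 * w * (P / a)^-1 ^+ l.+1 * b = q2 * (b * w) * (P / a)^-1 ^+ l.+1 by ring.
    rewrite ebw expr_div_n exprVn expr_div_n; field; nonzero.
  apply: (subD hD); first by apply: (subM hD); [apply: a'D | apply: laur_gen].
  apply: (subM hD); last exact: (subX hD).
  by apply: (subM hD); [apply: RD | move: hw; apply: adj_min].
pose C := adj (adj (adj (adj R a) (P / a)) b) (Q / b).
have h1 := adj_subring hR a; have h2 := adj_subring h1 (P / a).
have h3 := adj_subring h2 b; have hC : subringP C := adj_subring h3 (Q / b).
pose C0 := adj (adj (adj R a) (P / a)) b.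
have hC0 : subringP C0 by [].
have aC0 : C0 a by do 2!apply: adj_in => //; apply: adj_gen.
have a'C0 : C0 (P / a) by apply: adj_in => //; apply: adj_gen.
have bC0 : C0 b by apply: adj_gen.
have RC0 x : R x -> C0 x by move=> h; do 3!apply: adj_in => //.
have C0C x : C0 x -> C x by apply: adj_in.
have a'D1 : D (P / a) by apply: a'D; apply: laur_gen.
have CD x : C x -> D x.
  exact: (adj_min hD (adj_min hD (adj_min hD (adj_min hD RD aD) a'D1) bD) b'D).
have hB := laur_subring hRb a'0.
have CB x : C x -> laur (laur R b) (P / a) x.
  have b1 z : laur R b z -> laur (laur R b) (P / a) z by apply: laur_in.
  have a1 : laur (laur R b) (P / a) a.
    rewrite [X in laur _ _ X](_ : a = P * (P / a)^-1); last by field; nonzero.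
    by apply: (subM hB); [apply: b1 | apply: laur_inv].
  have RB z : R z -> laur (laur R b) (P / a) z by move=> hz; apply: b1; apply: laur_in.
  have bB : laur (laur R b) (P / a) b by apply: b1; apply: laur_gen.
  have a'B : laur (laur R b) (P / a) (P / a) by apply: laur_gen.
  have b'B : laur (laur R b) (P / a) (Q / b).
    apply: (subM hB); last by apply: b1; apply: laur_inv.
    rewrite eQ; apply: (subD hB); first exact: RB.
    by apply: (subM hB); [apply: RB | apply: (subX hB)].
  exact: (adj_min hB (adj_min hB (adj_min hB (adj_min hB RB a1) a'B) bB) b'B).
pose J := adj (laur R a) b.
have hJ : subringP J := adj_subring hRa b.
have aJ x : laur R a x -> J x by apply: adj_in.
have bJ : J b by apply: adj_gen.
have RJ x : R x -> J x by move=> h; apply: aJ; apply: laur_in.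
have PJ : J P by move: hPb0; apply: adj_min.
have C0J x : C0 x -> J x.
  have a1J : J a by apply: aJ; apply: laur_gen.
  have a'J : J (P / a) by apply: (subM hJ) => //; apply: aJ; apply: laur_inv.
  exact: (adj_min hJ (adj_min hJ (adj_min hJ RJ a1J) a'J) bJ).
have J1 x : J x -> exists c z, [/\ C0 c, J z & x = c + b * z].
  (* C0 + b J is closed under the ring operations, so only generators of J need a decomposition, and
     1/a is the only one not in C0. *)
  pose J' x := exists c z, [/\ C0 c, J z & x = c + b * z].
  have hJ' : subringP J'.
    split.
    - by exists 1, 0; rewrite mulr0 addr0; split=> //; [apply: (sub1 hC0) | apply: (sub0 hJ)].
    - move=> _ _ [c [z [hc hz ->]]] [c' [z' [hc' hz' ->]]]; exists (c - c'), (z - z').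
      by split; [apply: (subB hC0) | apply: (subB hJ) | ring].
    - move=> _ _ [c [z [hc hz ->]]] [c' [z' [hc' hz' ->]]].
      exists (c * c'), (c * z' + z * (c' + b * z')).
      split; [exact: (subM hC0) | | ring].
      apply: (subD hJ); apply: (subM hJ) => //; first exact: C0J.
      by apply: (subD hJ); [exact: C0J | apply: (subM hJ)].
  have C0J' z : C0 z -> J' z.
    by move=> h; exists z, 0; rewrite mulr0 addr0; split=> //; apply: (sub0 hJ).
  apply: (@adj_min _ _ J' b hJ' _ (C0J' _ bC0)).
  apply: (@laur_min _ _ J' a hJ'); [by move=> z h; apply: C0J'; apply: RC0 | exact: C0J' |].
  (* Solve P / a = p1 / a + p2 b^(k+1) / a for 1/a. *)
  exists (p1^-1 * (P / a)), (- (p1^-1 * p2 * b ^+ k * a^-1)); split.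
  - by apply: (subM hC0) => //; apply: RC0.
  - apply: (subN hJ); apply: (subM hJ); last by apply: aJ; apply: laur_inv.
    apply: (subM hJ); last exact: (subX hJ).
    by apply: RJ; apply: (subM hR).
  - by rewrite eP exprS; field; nonzero.
have JN N x : J x -> exists c z, [/\ C0 c, J z & x = c + b ^+ N * z].
  elim: N x => [|N IH] x hx.
    by exists 0, x; rewrite expr0 mul1r add0r; split=> //; apply: (sub0 hC0).
  have [c [z [hc hz ->]]] := IH x hx; have [c' [z' [hc' hz' ->]]] := J1 z hz.
  exists (c + b ^+ N * c'), z'; split=> //; last by rewrite exprSr; ring.
  by apply: (subD hC0) => //; apply: (subM hC0) => //; apply: (subX hC0).
have [u [v [hu hv ey]]] : exists u v, [/\ polyIn (laur R a) u, polyIn (laur R a) v &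
    y = u.[b] + v.[Q / b]].
  apply: (@laur_inter _ (laur R a) (laur R a) b _ Q 1) => //.
  - exact: (sub1 hRa).
  - by move=> z l' hz [w' hw']; rewrite mul1r => ->; exists w'.
  - exact: laur_swap.
  - by rewrite mul1r.
have [y1 [y2 [hy1 hy2 ey12]]] : exists y1 y2, [/\ C y1, J y2 & y = y1 + y2].
  have [y1 [y2 [hy1 hy2 e12]]] : exists y1 y2, [/\ C y1, J y2 & v.[Q / b] = y1 + y2].
    rewrite horner_coef; apply: (big_ind (fun x => exists y1 y2, [/\ C y1, J y2 & x = y1 + y2])).
    - by exists 0, 0; rewrite addr0; split=> //; [apply: (sub0 hC) | apply: (sub0 hJ)].
    - move=> _ _ [c [z [hc hz ->]]] [c' [z' [hc' hz' ->]]]; exists (c + c'), (z + z').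
      by split; [apply: (subD hC) | apply: (subD hJ) | ring].
    (* Taking N = i, the remainder b^i z cancels the pole of (Q/b)^i and leaves Q^i z in J. *)
    - move=> i _; have [c [z [hc hz ->]]] := JN i v`_i (aJ _ (hv i)).
      exists (c * (Q / b) ^+ i), (Q ^+ i * z); split.
      + by apply: (subM hC); [apply: C0C | apply: (subX hC); apply: adj_gen].
      + by apply: (subM hJ) => //; apply: (subX hJ); apply: aJ.
      + by rewrite expr_div_n; field; rewrite expf_neq0.
  exists y1, (u.[b] + y2); split=> //; last by rewrite ey e12 addrCA.
  apply: (subD hJ) => //; apply: (polyIn_horner hJ) => //.
  by apply: polyIn_sub hu.
have hy2a : laur (laur R b) (P / a) y2.
  have -> : y2 = y - y1 by rewrite ey12 addrC addKr.
  by apply: (subB hB) => //; apply: CB.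
have hy2b : laur (adj R b) a y2.
  have hJa := laur_subring hRb0 a0.
  move: hy2; apply: (@adj_min _ _ (laur (adj R b) a) b hJa).
    by apply: laur_mono => // x; apply: adj_in.
  by apply: laur_in => //; apply: adj_gen.
rewrite ey12; apply: (subD hD); first exact: CD.
(* The fourth ring contains b but not obviously 1/b, so the coefficients must be kept in R[b].
   Divisibility by a power of P descends from R[b^(+-1)] to R[b] by [adj_of_laur]. *)
have [u' [v' [hu' hv' ->]]] : exists u v, [/\ polyIn (adj R b) u, polyIn (adj R b) v &
    y2 = u.[a] + v.[P / a]].
  apply: (@laur_inter _ (adj R b) (laur R b) a _ P 1) => //.
  - exact: laur_adj.
  - exact: (sub1 hRb).
  - move=> z m hz [w' hw']; rewrite mul1r => ez; exists w' => //.
    apply: (@adj_of_laur R b p1 p2 k w' m) => //.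
    by rewrite -eP mulrC -ez.
  - by rewrite mul1r.
have bD' x : adj R b x -> D x by apply: (adj_min hD RD bD).
apply: (subD hD); apply: (polyIn_horner hD) => //.
- exact: polyIn_sub hu'.
- exact: polyIn_sub hv'.
Qed.

End Star.

(** * Binomials in a Laurent ring *)

Section Binomial.
Variable F : fieldType.
Variables (S : F -> Prop) (hS : subringP S) (g : F) (hg : transc S g) (g0 : g != 0).

(** For r < 0 the unit s g^r is factored out, so up to a unit the binomial is a polynomial in g with
    constant term 1. *)
Lemma binomial_norm (s : F) (r : int) : S s -> S s^-1 -> s != 0 -> r != 0 ->
  exists c t k, [/\ laur S g c, laur S g c^-1, c != 0, S t &
    1 + s * g ^ r = c * (1 + t * g ^+ k.+1)] /\ t != 0.
Proof.
have hL := laur_subring hS g0.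
case: r => [[//|k]|k] hs hs' s0 _.
  exists 1, s, k; rewrite invr1 mul1r oner_eq0 -exprnP; split=> //; split=> //; exact: (sub1 hL).
exists (s / g ^+ k.+1), s^-1, k; rewrite NegzE -exprnN invr_eq0; split=> //; split=> //.
- apply: (subM hL); first exact: laur_in.
  by rewrite -exprVn; apply: (subX hL); apply: laur_inv.
- rewrite invf_div; apply: (subM hL); last exact: laur_in.
  by apply: (subX hL); apply: laur_gen.
- by nonzero.
- by field; nonzero.
Qed.

(** By [laur_unit] a unit has a single term in g, and the binomial has two. *)
Lemma binomial_nonunit (s : F) (r : int) x :
  S s -> S s^-1 -> s != 0 -> r != 0 -> laur S g x -> (1 + s * g ^ r) * x <> 1.
Proof.
move=> hs hs' s0 r0 hx e; have hL := laur_subring hS g0.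
have [c [t [k [[hc hc' c0 ht ec] t0]]]] := binomial_norm hs hs' s0 r0.
have h1 : laur S g (1 + t * g ^+ k.+1).
  apply: (subD hL); first exact: (sub1 hL).
  by apply: (subM hL); [apply: laur_in | apply: (subX hL); apply: laur_gen].
have h2 : laur S g (c * x) by apply: (subM hL).
have e12 : (1 + t * g ^+ k.+1) * (c * x) = 1 by rewrite mulrA [_ * c]mulrC -ec.
have [u [_ [m [hu _ _ em]]]] := laur_unit hS hg g0 h1 h2 e12.
have key N M : (m = N%:Z - M%:Z) -> (1 + t *: 'X^(k.+1)) * 'X^M = u *: 'X^N :> {poly F}.
  move=> eNM; apply: (transc_inj hS hg).
  - apply: (polyInM hS); last exact: (polyInXn hS).
    apply: (polyInD hS); last by apply: (polyInZ hS) => //; apply: (polyInXn hS).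
    by rewrite -polyC1; apply: (polyInC hS); apply: (sub1 hS).
  - by apply: (polyInZ hS) => //; apply: (polyInXn hS).
  - rewrite -polyC1 !hornerFE em eNM -mulrA; congr (_ * _).
    by rewrite !exprnP -expfzDr // subrK.
have [N [M eNM]] : exists N M : nat, m = N%:Z - M%:Z.
  case: (m) => q; [exists q, 0%N | exists 0%N, q.+1]; lia.
have ep := key N M eNM.
have := congr1 (fun p : {poly F} => p`_M) ep.
rewrite coefMXn ltnn subnn coefD coef1 !coefZ !coefXn /= mulr0 addr0.
case: eqP => [eMN|_]; last by rewrite mulr0 => /eqP; rewrite oner_eq0.
move=> _; have := congr1 (fun p : {poly F} => p`_(M + k.+1)) ep.
rewrite coefMXn ltnNge leq_addr /= addKn coefD coef1 !coefZ !coefXn /= eqxx add0r mulr1.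
have -> : (M + k.+1 == N)%N = false by rewrite -eMN; apply/eqP; lia.
by rewrite mulr0 => /eqP; rewrite (negbTE t0).
Qed.

(** The normalized binomial has constant term 1, so the coefficients of y can be divided by E
    recursively, from the lowest degree upwards. *)
Lemma dvd_binomial (E s : F) (r : int) x y :
  S E -> E != 0 -> S s -> S s^-1 -> s != 0 -> r != 0 ->
  laur S g x -> laur S g y -> E * x = (1 + s * g ^ r) * y -> laur S g (y / E).
Proof.
move=> hE E0 hs hs' s0 r0 hx hy e; have hL := laur_subring hS g0.
have [c [t [k [[hc hc' c0 ht ec] t0]]]] := binomial_norm hs hs' s0 r0.
suff : laur S g (c * y / E).
  by move=> h; rewrite -[y](mulKf c0) -mulrA; apply: (subM hL).
have {}e : E * x = (1 + t * g ^+ k.+1) * (c * y) by rewrite e ec; ring.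
move: (c * y) e (subM hL hc hy) => {hy}y e hy.
move: hx hy e => [f [N [hf ->]]] [h [M [hh ->]]] e.
have ep : E *: (f * 'X^M) = (1 + t *: 'X^(k.+1)) * (h * 'X^N).
  apply: (transc_inj hS hg).
  - by apply: (polyInZ hS) => //; apply: (polyInM hS) => //; apply: (polyInXn hS).
  - apply: (polyInM hS); last by apply: (polyInM hS) => //; apply: (polyInXn hS).
    apply: (polyInD hS); last by apply: (polyInZ hS) => //; apply: (polyInXn hS).
    by rewrite -polyC1; apply: (polyInC hS); apply: (sub1 hS).
  - have -> : (E *: (f * 'X^M)).[g] = E * (f.[g] / g ^+ N) * g ^+ M * g ^+ N.
      by rewrite !hornerFE; field; nonzero.
    by rewrite e -polyC1 !hornerFE; field; nonzero.
have cS i : S ((h * 'X^N)`_i / E).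
  elim/ltn_ind: i => i IH.
  have := congr1 (fun p : {poly F} => p`_i / E) ep.
  rewrite coefZ mulrC mulKf // mulrDl mul1r coefD -scalerAl coefZ ['X^_ * _]mulrC.
  rewrite coefMXn [(h * 'X^N * _)`_i]coefMXn mulrDl => ei.
  have -> : (h * 'X^N)`_i / E = (if (i < M)%N then 0 else f`_(i - M))
      - t * ((if (i < k.+1)%N then 0 else (h * 'X^N)`_(i - k.+1)) / E).
    by rewrite ei mulrA addrK.
  apply: (subB hS); first by case: ifP => // _; apply: (sub0 hS).
  apply: (subM hS) => //; case: ltnP => hi; first by rewrite mul0r; apply: (sub0 hS).
  by apply: IH; lia.
exists (E^-1 *: h), M; split; last by rewrite hornerZ; field; nonzero.
move=> i; rewrite coefZ mulrC.
by have := cS (i + N)%N; rewrite coefMXn ltnNge leq_addl /= addnK.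
Qed.

(** Modulo 1 + m the unit m is -1, also in negative powers. *)
Lemma sign_congr (R : F -> Prop) m (k : int) : subringP R -> R m -> R m^-1 -> m != 0 ->
  exists2 w, R w & m ^ k - (-1) ^ k = (1 + m) * w.
Proof.
move=> hR hm hm' m0.
have pos (x : F) q : R x -> exists2 w, R w & x ^+ q - (-1) ^+ q = (1 + x) * w.
  move=> hx; elim: q => [|q [w hw ew]].
    by exists 0; [apply: (sub0 hR) | rewrite !expr0 subrr mulr0].
  exists ((-1) ^+ q + x * w).
    apply: (subD hR); last exact: (subM hR).
    by apply: (subX hR); apply: (subN hR); apply: (sub1 hR).
  have -> : x ^+ q.+1 - (-1) ^+ q.+1 = (1 + x) * (-1) ^+ q + x * (x ^+ q - (-1) ^+ q).
    by rewrite !exprS; ring.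
  by rewrite ew; ring.
case: k => q; first by rewrite -!exprnP; apply: pos.
have [w hw ew] := pos m^-1 q.+1 hm'.
exists (m^-1 * w); first exact: (subM hR).
rewrite NegzE -!exprnN -!exprVn invrN1 ew; field; exact: m0.
Qed.

(* A combination of mu = s g^r and nu = s' g^r' without g is congruent to a sign
   modulo (1 + mu, 1 + nu); this puts a non-zero element E of S in that ideal. *)
Lemma binomial_coprime (s s' : F) (r r' : int) :
  S s -> S s^-1 -> s != 0 -> S s' -> S s'^-1 -> s' != 0 -> r' != 0 ->
  (s * g ^ r) ^ r' * (s' * g ^ r') ^ (- r) != (-1) ^ r' * (-1) ^ (- r) ->
  forall z m l, laur S g z ->
    (exists2 w, laur S g w & (1 + s * g ^ r) ^+ m * z = (1 + s' * g ^ r') ^+ l * w) ->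
    exists2 w, laur S g w & z = (1 + s' * g ^ r') ^+ l * w.
Proof.
move=> hs hsV s0 hs' hsV' s0' r0 hE; have hL := laur_subring hS g0.
have gz (k : int) : laur S g (g ^ k).
  by apply: (subXz hL); [apply: laur_gen | apply: laur_inv].
have gV (k : int) : laur S g (g ^ k)^-1 by rewrite invr_expz; apply: gz.
have gk0 (k : int) : g ^ k != 0 by apply: expfz_neq0.
set mu := s * g ^ r; set nu := s' * g ^ r'.
have mu0 : mu != 0 by rewrite mulf_neq0.
have nu0 : nu != 0 by rewrite mulf_neq0.
have hmu : laur S g mu by apply: (subM hL) => //; apply: laur_in.
have hnu : laur S g nu by apply: (subM hL) => //; apply: laur_in.
have hmuV : laur S g mu^-1 by rewrite invfM; apply: (subM hL) => //; apply: laur_in.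
have hnuV : laur S g nu^-1 by rewrite invfM; apply: (subM hL) => //; apply: laur_in.
have hP : laur S g (1 + mu) by apply: (subD hL) => //; apply: (sub1 hL).
have hQ : laur S g (1 + nu) by apply: (subD hL) => //; apply: (sub1 hL).
pose E := mu ^ r' * nu ^ (- r) - (-1) ^ r' * (-1) ^ (- r).
have E0 : E != 0 by rewrite subr_eq0.
have ES : S E.
  apply: (subB hS); last first.
    have m1 : S (-1) by apply: (subN hS); apply: (sub1 hS).
    by apply: (subM hS); apply: (subXz hS); rewrite ?invrN1.
  have -> : mu ^ r' * nu ^ (- r) = s ^ r' * s' ^ (- r).
    rewrite /mu /nu !expfzMl ?gk0 // !exprz_exp mulrACA -expfzDr //.
    by rewrite (_ : r * r' + r' * - r = 0) ?expr0z ?mulr1 //; ring.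
  by apply: (subM hS); apply: (subXz hS).
have [w1 hw1 e1] := sign_congr r' hL hmu hmuV mu0.
have [w2 hw2 e2] := sign_congr (- r) hL hnu hnuV nu0.
have EPQ : E = (1 + mu) * ((-1) ^ (- r) * w1) + (1 + nu) * (mu ^ r' * w2).
  have -> : (1 + mu) * ((-1) ^ (- r) * w1) = (-1) ^ (- r) * ((1 + mu) * w1) by ring.
  have -> : (1 + nu) * (mu ^ r' * w2) = mu ^ r' * ((1 + nu) * w2) by ring.
  rewrite -e1 -e2 /E; ring.
have h1 : laur S g ((-1) ^ (- r) * w1).
  apply: (subM hL) => //; apply: (subXz hL); rewrite ?invrN1;
  by apply: (subN hL); apply: (sub1 hL).
have h2 : laur S g (mu ^ r' * w2) by apply: (subM hL) => //; apply: (subXz hL).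
have Q0 : 1 + nu != 0.
  apply/eqP => q0.
  have [c [t [k [[_ _ c0 ht ec] t0]]]] := binomial_norm hs' hsV' s0' r0.
  move/eqP: q0; rewrite /nu ec mulf_eq0 (negbTE c0) /= => /eqP q0.
  have : 1 + t *: 'X^(k.+1) = 0 :> {poly F}.
    apply: hg; last by rewrite -polyC1 !hornerFE.
    apply: (polyInD hS); last by apply: (polyInZ hS) => //; apply: (polyInXn hS).
    by rewrite -polyC1; apply: (polyInC hS); apply: (sub1 hS).
  move=> /(congr1 (fun p : {poly F} => p`_0)) /eqP.
  by rewrite coefD coef1 coefZ coefXn coef0 /= mulr0 addr0 oner_eq0.
(* Both parts of E z are multiples of 1 + nu; E lies in S and can be divided out of the cofactor by
   [dvd_binomial]. *)
have one z : laur S g z -> (exists2 w, laur S g w & (1 + mu) * z = (1 + nu) * w) ->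
    exists2 w, laur S g w & z = (1 + nu) * w.
  move=> hz [w hw ew].
  pose v := (-1) ^ (- r) * w1 * w + mu ^ r' * w2 * z.
  have hv : laur S g v by apply: (subD hL); apply: (subM hL).
  have Ez : E * z = (1 + nu) * v.
    have -> : E * z = (-1) ^ (- r) * w1 * ((1 + mu) * z) + (1 + nu) * (mu ^ r' * w2) * z.
      by rewrite EPQ; ring.
    by rewrite ew /v; ring.
  exists (v / E); first exact: (dvd_binomial ES E0 hs' hsV' s0' r0 hz hv Ez).
  by apply: (mulfI E0); rewrite Ez; field; nonzero.
have onel l z : laur S g z -> (exists2 w, laur S g w & (1 + mu) * z = (1 + nu) ^+ l * w) ->
    exists2 w, laur S g w & z = (1 + nu) ^+ l * w.
  elim: l z => [|l IH] z hz [w hw ew].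
    by exists z => //; rewrite expr0 mul1r.
  have [|z' hz' ez] := one z hz.
    by exists ((1 + nu) ^+ l * w); [apply: (subM hL) => //; apply: (subX hL) | rewrite ew exprS mulrA].
  have [|w' hw' ew'] := IH z' hz'.
    exists w => //; apply: (mulfI Q0); rewrite mulrCA -ez ew exprS; ring.
  by exists w' => //; rewrite ez ew' exprS mulrA.
move=> z m l; elim: m z => [|m IH] z hz [w hw ew].
  by exists w => //; rewrite -ew expr0 mul1r.
apply: onel => //; apply: IH; first by apply: (subM hL).
by exists w => //; rewrite -ew exprSr; ring.
Qed.

End Binomial.

(** * Laurent rings of independent families *)

Lemma expz_prod (F : fieldType) (I : finType) (g : I -> F) (m : int) :
  (\prod_i g i) ^ m = \prod_i g i ^ m.
Proof. by elim/big_rec2: _ => [|i x y _ <-]; rewrite ?exp1rz ?expfzMl. Qed.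

Section Family.
Variables (F : fieldType) (I : finType).
Implicit Types (f : I -> F) (P : pred I) (e : I -> int).

(** The Laurent ring in the f_i with P i over the image of Z. In this impredicative form a
    membership hypothesis is itself the induction principle: it is applied to a suitable subring. *)
Definition Lau f P (x : F) : Prop :=
  forall T : F -> Prop, subringP T -> (forall i, P i -> T (f i) /\ T (f i)^-1) -> T x.

Lemma Lau_subring f P : subringP (Lau f P).
Proof.
split.
- by move=> T hT _; apply: (sub1 hT).
- by move=> x y hx hy T hT h; apply: (subB hT); [apply: hx | apply: hy].
- by move=> x y hx hy T hT h; apply: (subM hT); [apply: hx | apply: hy].
Qed.

Lemma Lau_gen f P i : P i -> Lau f P (f i).
Proof. by move=> hi T _ h; case: (h i hi). Qed.

Lemma Lau_inv f P i : P i -> Lau f P (f i)^-1.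
Proof. by move=> hi T _ h; case: (h i hi). Qed.

Lemma Lau_mono f f' P P' : (forall i, P i -> f i = f' i) -> (forall i, P i -> P' i) ->
  forall x, Lau f P x -> Lau f' P' x.
Proof.
move=> hf hP x; apply; first exact: Lau_subring.
by move=> i Pi; rewrite hf //; split; [apply: Lau_gen | apply: Lau_inv]; apply: hP.
Qed.

Definition off i P : pred I := fun l => (l != i) && P l.

Lemma Lau_laur f P i : f i != 0 -> forall x, Lau f P x -> laur (Lau f (off i P)) (f i) x.
Proof.
move=> fi0 x; have hS := Lau_subring f (off i P).
apply; first exact: laur_subring.
move=> l Pl; case: (eqVneq l i) => [->|ne].
  by split; [apply: laur_gen | apply: laur_inv].
by split; apply: laur_in => //; [apply: Lau_gen | apply: Lau_inv]; rewrite /off ne.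
Qed.

Lemma laur_Lau f P i : P i -> forall x, laur (Lau f (off i P)) (f i) x -> Lau f P x.
Proof.
move=> Pi; apply: laur_min; [exact: Lau_subring | | exact: Lau_gen | exact: Lau_inv].
by move=> x; apply: Lau_mono => // l /andP[].
Qed.

Definition mon f e : F := \prod_i f i ^ e i.

(** Algebraic independence over the image of Z, stated for one element over the others. *)
Definition indep f : Prop :=
  (forall i, f i != 0) /\ (forall i, transc (Lau f (predC1 i)) (f i)).

Lemma eq_mon f e e' : e =1 e' -> mon f e = mon f e'.
Proof. by move=> h; apply: eq_bigr => i _; rewrite h. Qed.

Lemma monD f e e' : (forall i, f i != 0) -> mon f (fun i => e i + e' i) = mon f e * mon f e'.
Proof. by move=> h; rewrite /mon -big_split /=; apply: eq_bigr => i _; rewrite expfzDr. Qed.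

Lemma mon0 f : mon f (fun=> 0) = 1.
Proof. by rewrite /mon big1. Qed.

Lemma mon_neq0 f e : (forall i, f i != 0) -> mon f e != 0.
Proof. by move=> h; apply/prodf_neq0 => i _; apply: expfz_neq0. Qed.

Lemma monN f e : mon f (fun i => - e i) = (mon f e)^-1.
Proof. by rewrite /mon -prodfV; apply: eq_bigr => i _; rewrite -invr_expz. Qed.

Lemma monZ f e (k : int) : mon f (fun i => e i * k) = mon f e ^ k.
Proof.
by rewrite /mon expz_prod; apply: eq_bigr => i _; rewrite exprz_exp.
Qed.

Lemma mon_Lau f e P : (forall i, ~~ P i -> e i = 0) -> Lau f P (mon f e).
Proof.
move=> h; apply: (sub_prod (Lau_subring f P)) => i _.
have [Pi|nPi] := boolP (P i); last by rewrite h // expr0z; apply: (sub1 (Lau_subring f P)).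
by apply: (subXz (Lau_subring f P)); [apply: Lau_gen | apply: Lau_inv].
Qed.

Lemma monV_Lau f e P : (forall i, ~~ P i -> e i = 0) -> Lau f P (mon f e)^-1.
Proof. by move=> h; rewrite -monN; apply: mon_Lau => i /h ->; rewrite oppr0. Qed.

Definition zero_at i e : I -> int := fun l => if l == i then 0 else e l.

Lemma mon_split f e i : mon f e = f i ^ e i * mon f (zero_at i e).
Proof.
rewrite /mon (bigD1 i) //= [in RHS](bigD1 i) //= /zero_at eqxx expr0z mul1r.
by congr (_ * _); apply: eq_bigr => l /negbTE ->.
Qed.

Lemma eq_mon_fam f f' e : (forall i, e i != 0 -> f i = f' i) -> mon f e = mon f' e.
Proof.
move=> h; apply: eq_bigr => i _.
by case: (eqVneq (e i) 0) => [->|/h ->]; rewrite ?expr0z.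
Qed.

Lemma indep_transc f P i : indep f -> ~~ P i -> transc (Lau f P) (f i).
Proof.
move=> [_ h] nP; apply: transc_sub (h i) => x; apply: Lau_mono => // l Pl /=.
by apply: contraNneq nP => <-.
Qed.

Lemma transc_mon (S : F -> Prop) a c (k : int) : subringP S -> transc S a -> a != 0 ->
  S c -> S c^-1 -> c != 0 -> a ^ k = c -> k = 0.
Proof.
move=> hS ha a0 hc hc' c0; case: k => [[//|k]|k] e; exfalso.
- have : 'X^(k.+1) - c%:P = 0 :> {poly F}.
    apply: ha; last by rewrite !hornerFE -[RHS](subrr c) -{2}e.
    by apply: (polyInB hS); [apply: (polyInXn hS) | apply: (polyInC hS)].
  by move/eqP; rewrite -size_poly_eq0 size_XnsubC.
- have : 'X^(k.+1) - (c^-1)%:P = 0 :> {poly F}.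
    apply: ha; last by rewrite !hornerFE -[RHS](subrr c^-1) -{2}e NegzE -exprnN invrK.
    by apply: (polyInB hS); [apply: (polyInXn hS) | apply: (polyInC hS)].
  by move/eqP; rewrite -size_poly_eq0 size_XnsubC.
Qed.

Lemma mon_sign_eq f e (b : bool) : indep f -> mon f e = (-1) ^+ b -> forall i, e i = 0.
Proof.
move=> hf h i; have [f0 _] := hf.
pose S := Lau f (predC1 i); have hS : subringP S by apply: Lau_subring.
have hr (l : I) : ~~ predC1 i l -> zero_at i e l = 0 by rewrite /= negbK /zero_at => ->.
have m0 : mon f (zero_at i e) != 0 by apply: mon_neq0.
have hb : S ((-1) ^+ b) by apply: (subX hS); apply: (subN hS); apply: (sub1 hS).
apply: (@transc_mon S (f i) ((-1) ^+ b / mon f (zero_at i e))) => //.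
- by apply: indep_transc => //=; rewrite eqxx.
- by apply: (subM hS) => //; apply: monV_Lau.
- rewrite invfM invrK -exprVn invrN1; apply: (subM hS) => //; exact: mon_Lau.
- by rewrite mulf_neq0 ?invr_eq0 // signr_eq0.
- by rewrite -h (mon_split f e i) mulfK.
Qed.

Hypothesis char0 : forall m : int, m%:~R = 0 :> F -> m = 0.

(** Variables are split off one at a time by [laur_unit]. What remains is a unit in the image of Z,
    and characteristic 0 leaves only 1 and -1. *)
Lemma Lau_unit f P x y : indep f -> Lau f P x -> Lau f P y -> x * y = 1 ->
  exists (b : bool) e, (forall i, ~~ P i -> e i = 0) /\ x = (-1) ^+ b * mon f e.
Proof.
move=> hf; have [k] := ubnP #|P|; elim: k => // k IH in P x y *; rewrite ltnS => hk hx hy exy.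
case: (pickP P) => [i Pi | P0]; last first.
  pose isZ (x : F) := exists m : int, x = m%:~R.
  have hZ : subringP isZ.
    split; first by exists 1.
    - by move=> _ _ [m ->] [m' ->]; exists (m - m'); rewrite rmorphB.
    - by move=> _ _ [m ->] [m' ->]; exists (m * m'); rewrite rmorphM.
  have [|m em] := hx isZ hZ; first by move=> i; rewrite P0.
  have [|m' em'] := hy isZ hZ; first by move=> i; rewrite P0.
  have : m * m' = 1.
    by apply/eqP; rewrite -subr_eq0; apply/eqP/char0; rewrite rmorphB rmorphM /= -em -em' exy subrr.
  move=> /(congr1 absz); rewrite abszM => /eqP; rewrite muln_eq1 => /andP[/eqP am _].
  exists (m < 0), (fun=> 0); split=> //; rewrite mon0 mulr1 em.
  by rewrite [m in LHS]intEsign am mulr1 rmorph_sign.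
have [f0 _] := hf.
pose S := Lau f (off i P); have hS : subringP S by apply: Lau_subring.
have ti : transc S (f i) by apply: indep_transc => //; rewrite /off /= eqxx.
have [s [s' [m [hs hs' es ex]]]] := laur_unit hS ti (f0 i) (Lau_laur (f0 i) hx) (Lau_laur (f0 i) hy) exy.
have lt : (#|off i P| < k)%N.
  apply: leq_trans hk; apply: proper_card; apply/properP; split.
    by apply/subsetP => l /andP[].
  by exists i => //; rewrite unfold_in /off eqxx.
have [b [e [he es']]] := IH (off i P) s s' lt hs hs' es.
exists b, (fun l => if l == i then m else e l); split.
  move=> l nPl; case: eqP => [el|/eqP ne]; first by rewrite el Pi in nPl.
  by apply: he; rewrite /off ne.
rewrite ex es' -mulrA; congr (_ * _); rewrite [RHS](mon_split f _ i) eqxx mulrC; congr (_ * _).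
rewrite /zero_at; apply: eq_mon => l; case: eqP => [->|//].
by apply: he; rewrite /off eqxx.
Qed.

End Family.

Definition pos_part (x : int) : int := Num.max x 0.

Lemma pos_partN x : pos_part (- x) = pos_part x - x.
Proof. by rewrite /pos_part; lia. Qed.

Lemma pos_part_pos x : 0 <= x -> pos_part x = x.
Proof. by rewrite /pos_part; lia. Qed.

Lemma pos_part_neg x : x <= 0 -> pos_part x = 0.
Proof. by rewrite /pos_part; lia. Qed.

(** * Crossing two mutations, for families of seed variables *)

Section FamilyStar.
Variables (F : fieldType) (I : finType).
Implicit Types (f : I -> F) (v : I -> int).

(** For v the k-th column of the extended exchange matrix this is the exchange binomial P_k,
    coefficients included. *)
Definition binom f v : F :=
  mon f (fun l => pos_part (v l)) + mon f (fun l => pos_part (- v l)).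

Lemma binomN f v : binom f (fun l => - v l) = binom f v.
Proof. by rewrite /binom addrC; congr (_ + _); apply: eq_mon => l; rewrite ?opprK. Qed.

Lemma eq_binom f v v' : v =1 v' -> binom f v = binom f v'.
Proof. by move=> h; congr (_ + _); apply: eq_mon => l; rewrite h. Qed.

Lemma eq_binom_fam f f' v : (forall i, v i != 0 -> f i = f' i) -> binom f v = binom f' v.
Proof.
move=> h; congr (_ + _); apply: eq_mon_fam => i hi; apply: h;
by apply: contraNneq hi => ->; rewrite /pos_part ?oppr0 maxxx.
Qed.

Lemma binomE f v : (forall i, f i != 0) ->
  binom f v = mon f (fun l => pos_part (- v l)) * (1 + mon f v).
Proof.
move=> f0; rewrite mulrDr mulr1 -monD // addrC; congr (_ + _); apply: eq_mon => l.
by rewrite /pos_part; lia.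
Qed.

Lemma binom_Lau f v (P : pred I) : (forall i, ~~ P i -> v i = 0) -> Lau f P (binom f v).
Proof.
by move=> h; apply: (subD (Lau_subring f P)); apply: mon_Lau => i /h ->; rewrite /pos_part ?oppr0 maxxx.
Qed.

Variables (i j : I) (ij : i != j).

Definition rest : pred I := fun l => (l != i) && (l != j).

Lemma Lau_laur2 f g : (forall l, g l != 0) -> (forall l, rest l -> g l = f l) ->
  forall y, Lau g predT y -> laur (laur (Lau f rest) (g j)) (g i) y.
Proof.
move=> g0 e y /(Lau_laur (g0 i)); have hR := Lau_subring f rest.
apply: laur_mono => //; first exact: laur_subring.
move=> {}y /(Lau_laur (g0 j)).
apply: laur_mono => // {}y; apply: Lau_mono; last by move=> l /and3P[? ? _]; apply/andP.
by move=> l /and3P[? ? _]; apply: e; apply/andP.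
Qed.

Lemma laur2_Lau f g : (forall l, g l != 0) -> (forall l, rest l -> g l = f l) ->
  forall y, laur (laur (Lau f rest) (g i)) (g j) y -> Lau g predT y.
Proof.
move=> g0 e; have hT := Lau_subring g predT.
apply: (laur_min hT); [|exact: Lau_gen | exact: Lau_inv].
apply: (laur_min hT); [|exact: Lau_gen | exact: Lau_inv].
by move=> x; apply: Lau_mono => // l /e.
Qed.

(** These are the families of a seed t, of mu_i(t), of mu_j(t) and of mu_j(mu_i(t)); vi and vj are
    the columns i and j at t, up to a common sign. *)
Variables (f f1 f2 f12 : I -> F) (vi vj : I -> int).
Hypotheses (hf : indep f) (f10 : forall l, f1 l != 0) (f20 : forall l, f2 l != 0)
  (f120 : forall l, f12 l != 0).
Hypotheses (e1i : f1 i = binom f vi / f i) (e1 : forall l, l != i -> f1 l = f l)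
  (e2j : f2 j = binom f vj / f j) (e2 : forall l, l != j -> f2 l = f l).
Hypotheses (vii : vi i = 0) (vjj : vj j = 0).

Let f0 l : f l != 0. Proof. by case: hf. Qed.
Let P0 : binom f vi != 0.
Proof. by have := f10 i; rewrite e1i mulf_eq0 negb_or => /andP[]. Qed.
Let Q0 : binom f vj != 0.
Proof. by have := f20 j; rewrite e2j mulf_eq0 negb_or => /andP[]. Qed.

Let tij : transc (laur (Lau f rest) (f j)) (f i).
Proof.
have [_ h] := hf; apply: transc_sub (h i) => x.
apply: (laur_min (Lau_subring f (predC1 i))).
- by move=> {}x; apply: Lau_mono => // l /andP[].
- by apply: Lau_gen; rewrite /= eq_sym.
- by apply: Lau_inv; rewrite /= eq_sym.
Qed.

Let tji : transc (laur (Lau f rest) (f i)) (f j).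
Proof.
have [_ h] := hf; apply: transc_sub (h j) => x.
apply: (laur_min (Lau_subring f (predC1 j))).
- by move=> {}x; apply: Lau_mono => // l /andP[].
- exact: Lau_gen.
- exact: Lau_inv.
Qed.

Lemma star_fam_dep v1 y : vi j < 0 -> 0 < vj i ->
  v1 i = - vj i -> (forall l, l != i -> v1 l = vj l + vj i * pos_part (vi l)) ->
  (forall l, l != j -> f12 l = f1 l) -> f12 j = binom f1 v1 / f1 j ->
  Lau f predT y -> Lau f1 predT y -> Lau f2 predT y -> Lau f12 predT y.
Proof.
move=> hij hji ev1i ev1 e12 e12j hy hy1 hy2.
have hR := Lau_subring f rest.
have ji : j != i by rewrite eq_sym.
have v1j : v1 j = 0 by rewrite ev1 // vjj /pos_part; nia.
have f1j : f1 j = f j by apply: e1.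
apply: (@laur2_Lau f) => //.
  by move=> l /andP[li lj]; rewrite e12 ?e1.
rewrite e12 // e1i.
have mR e : e i = 0 -> e j = 0 -> Lau f rest (mon f e).
  move=> ei ej; apply: mon_Lau => l; rewrite /rest negb_and !negbK => /orP[] /eqP ->; done.
have mVR e : e i = 0 -> e j = 0 -> Lau f rest (mon f e)^-1.
  move=> ei ej; apply: monV_Lau => l; rewrite /rest negb_and !negbK => /orP[] /eqP ->; done.
have [k ek] : exists k : nat, - vi j = k.+1%:Z by exists (`|vi j|.-1)%N; lia.
have [l el] : exists l : nat, vj i = l.+1%:Z by exists (`|vj i|.-1)%N; lia.
pose p1 := mon f (fun l => pos_part (vi l)).
pose p2 := mon f (zero_at j (fun l => pos_part (- vi l))).
pose q1 := mon f (fun l => pos_part (- vj l)).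
pose q2 := mon f (zero_at i (fun l => pos_part (vj l))).
have eP : binom f vi = p1 + p2 * f j ^+ k.+1.
  rewrite /binom -/p1 (mon_split f (fun l => pos_part (- vi l)) j) mulrC; congr (_ + _ * _).
  by rewrite exprnP -ek /pos_part; congr (_ ^ _); lia.
have eQ : binom f vj = q1 + q2 * f i ^+ l.+1.
  rewrite /binom addrC -/q1 (mon_split f (fun l => pos_part (vj l)) i) mulrC; congr (_ + _ * _).
  by rewrite exprnP -el /pos_part; congr (_ ^ _); lia.
have mf1 e : e i = 0 -> mon f1 e = mon f e.
  by move=> ei; apply: eq_mon_fam => m hm; apply: e1; apply: contraNneq hm => ->; rewrite ei.
have L1 x : Lau f1 (predC1 j) x -> laur (Lau f rest) (binom f vi / f i) x.
  rewrite -e1i => /(Lau_laur (f10 i)); apply: laur_mono => // {}x.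
  by apply: Lau_mono => m /andP[m1 m2]; [apply: e1 | apply/andP].
(* This monomial brings the binomial of the second mutation into the form q1 + q2 (p1/a')^(l+1),
   with a' = f1 i, that [star_dep] expects. *)
pose e := q1 / mon f1 (fun l => pos_part (- v1 l)).
have q1R : Lau f rest q1 by apply: mR; rewrite /pos_part ?vjj; lia.
apply: (@star_dep F (Lau f rest) (f i) (f j) (binom f vi) (binom f vj) p1 p2 q1 q2 e (f12 j) y k l) => //.
- by apply: mR; rewrite /pos_part ?vii; lia.
- by apply: mVR; rewrite /pos_part ?vii; lia.
- exact: mon_neq0.
- by apply: mR; rewrite /zero_at ?eqxx // (negbTE ij) /pos_part vii; lia.
- by apply: mR; rewrite /zero_at ?eqxx // (negbTE ji) /pos_part vjj; lia.
- have hL : subringP (laur (Lau f rest) (binom f vi / f i)) by apply: laur_subring => //; rewrite -e1i.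
  apply: (subM hL); first by apply: laur_in.
  by apply: L1; apply: monV_Lau => m; rewrite /= negbK => /eqP ->; rewrite v1j /pos_part; lia.
- rewrite e12j f1j [f j * _]mulrC divfK //; apply: L1; apply: binom_Lau => m.
  by rewrite /= negbK => /eqP ->.
- rewrite e12j f1j [f j * _]mulrC divfK // binomE // /e mulrA divfK ?mon_neq0 //.
  rewrite mulrDr mulr1; congr (_ + _); rewrite (mon_split f1 v1 i) ev1i mf1; last by rewrite /zero_at eqxx.
  have -> : mon f (zero_at i v1) = mon f (zero_at i vj) * p1 ^ vj i.
    rewrite /p1 -monZ -monD //; apply: eq_mon => m; rewrite /zero_at.
    by case: eqP => [->|/eqP hm]; rewrite ?vii ?ev1 // ?[vj i * _]mulrC // /pos_part; lia.
  have -> : q2 = q1 * mon f (zero_at i vj).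
    rewrite /q1 -monD //; apply: eq_mon => m; rewrite /zero_at.
    by case: eqP => [->|_]; rewrite /pos_part; lia.
  rewrite -!mulrA; congr (_ * _); rewrite mulrCA; congr (_ * _).
  by rewrite -e1i expr_div_n exprnP -el mulrC exprnP -el invr_expz.
- exact: Lau_laur2.
- rewrite -e1i -f1j; apply: Lau_laur2 => // m /andP[mi _]; exact: e1.
- rewrite -e2j -(e2 ij); apply: laur_swap => //.
  by apply: Lau_laur2 => // m /andP[_ mj]; apply: e2.
Qed.

Lemma star_fam_indep y : vi j = 0 -> vj i = 0 ->
  (forall c d : int, (forall l, vi l * c + vj l * d = 0) -> c = 0 /\ d = 0) ->
  (forall l, l != j -> f12 l = f1 l) -> f12 j = binom f vj / f j ->
  Lau f predT y -> Lau f1 predT y -> Lau f2 predT y -> Lau f12 predT y.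
Proof.
move=> vij vji lin e12 e12j hy hy1 hy2.
have hR := Lau_subring f rest.
have f1j : f1 j = f j by apply: e1; rewrite eq_sym.
have out v : v i = 0 -> v j = 0 -> forall l, ~~ rest l -> v l = 0.
  by move=> hi hj l; rewrite /rest negb_and !negbK => /orP[] /eqP ->.
apply: (@laur2_Lau f) => //.
  by move=> l /andP[li lj]; rewrite e12 ?e1.
rewrite e12 // e1i e12j -[binom f vj / f j]mul1r.
have h1 : Lau f rest 1 := sub1 hR.
apply: star_indep => //; rewrite ?invr1 ?oner_eq0 //.
- by apply: binom_Lau; apply: out.
- by apply: binom_Lau; apply: out.
(* Independence makes the column vj non-zero; a variable f q that occurs in it plays the role of g
   in [binomial_coprime]. *)
- have [q vjq] : exists q, vj q != 0.
    apply: NNPP => h; have [|_ /eqP] := lin 0 1; last by rewrite oner_eq0.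
    move=> l; rewrite mulr0 add0r mulr1; apply/eqP; apply: contraT => hl.
    by case: h; exists l.
  have rq : rest q.
    apply/andP; split; apply: contraNneq vjq => -> //; by rewrite ?vji ?vjj.
  pose S := Lau f (off q rest); have hS : subringP S by apply: Lau_subring.
  have tq : transc S (f q) by apply: indep_transc => //; rewrite /off eqxx.
  have Sz v l : v i = 0 -> v j = 0 -> ~~ off q rest l -> zero_at q v l = 0.
    rewrite /zero_at /off negb_and negbK => hi hj; case: eqP => //= _; exact: out.
  move=> z m l hz [w hw ew].
  have U v : v i = 0 -> v j = 0 ->
      Lau f rest (mon f (fun l => pos_part (- v l))) /\ Lau f rest (mon f (fun l => pos_part (- v l)))^-1.
    by move=> hi hj; split; [apply: mon_Lau | apply: monV_Lau] => r hr;
      rewrite (out v) // /pos_part oppr0 maxxx.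
  have [ci ciV] := U vi vii vij; have [cj cjV] := U vj vji vjj.
  move: ew; rewrite !binomE //.
  set Ci := mon f _ in ci ciV *; set Cj := mon f _ in cj cjV *.
  have Ci0 : Ci != 0 by apply: mon_neq0.
  have Cj0 : Cj != 0 by apply: mon_neq0.
  rewrite !exprMn => ew.
  have [|||||||||w' hw' ->] := @binomial_coprime F S hS (f q) tq (f0 q)
     (mon f (zero_at q vi)) (mon f (zero_at q vj)) (vi q) (vj q) _ _ _ _ _ _ vjq _ z m l.
  + by apply: mon_Lau => r; apply: Sz.
  + by apply: monV_Lau => r; apply: Sz.
  + exact: mon_neq0.
  + by apply: mon_Lau => r; apply: Sz.
  + by apply: monV_Lau => r; apply: Sz.
  + exact: mon_neq0.
  (* If the combination without f q were a sign, its exponent vector would vanish, giving a linear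
     relation between vi and vj with the non-zero coefficient vj q. *)
  + rewrite ![mon f (zero_at q _) * _]mulrC -!mon_split -!monZ -monD //.
    apply/eqP; rewrite -expfzDr ?oppr_eq0 ?oner_eq0 // => h.
    have [b hb] : exists b : bool, (-1) ^ (vj q - vi q) = (-1) ^+ b :> F.
      case: (vj q - vi q) => r; first by exists (odd r); rewrite signr_odd.
      by exists (odd r.+1); rewrite signr_odd NegzE -exprnN -exprVn invrN1.
    rewrite hb in h.
    by have [/eqP] := lin _ _ (mon_sign_eq hf h); rewrite (negbTE vjq).
  + exact: (Lau_laur (f0 q)).
  + exists (Cj ^+ l * w / Ci ^+ m).
      apply: (Lau_laur (f0 q)); apply: (subM hR); last by rewrite -exprVn; apply: (subX hR).
      by apply: (subM hR) => //; apply: (subX hR).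
    apply: (mulfI (expf_neq0 m Ci0)).
    rewrite -[mon f (zero_at q vi) * _]mulrC -[mon f (zero_at q vj) * _]mulrC -!mon_split.
    rewrite [LHS]mulrA ew; field; nonzero.
  + rewrite [mon f (zero_at q vj) * _]mulrC -mon_split.
    exists (w' / Cj ^+ l).
      apply: (subM hR); last by rewrite -exprVn; apply: (subX hR).
      by apply: (@laur_Lau _ _ f rest q rq).
    field; nonzero.
- exact: Lau_laur2.
- rewrite -e1i -f1j; apply: Lau_laur2 => // m /andP[mi _]; exact: e1.
- rewrite -e2j -(e2 ij); apply: laur_swap => //.
  by apply: Lau_laur2 => // m /andP[_ mj]; apply: e2.
Qed.

End FamilyStar.

(** * Integer polynomials positive at the faces of the cube *)

Section PositiveAtFaces.
Variable n : nat.
Implicit Types (P Q r : {mpoly int[n]}) (c : 'I_n -> int) (i j : 'I_n).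

(* Positivity at the point with Z_i = 0 and the other Z_j = 1 excludes
   divisibility by Z_i. *)
Definition face_positive P : Prop :=
  0 < P.@[fun=> 1] /\ forall i, 0 < P.@[fun j => (j != i)%:R].

Lemma face_positive_neq0 P : face_positive P -> P != 0.
Proof. by case=> h _; apply: contraTneq h => ->; rewrite meval0. Qed.

Lemma face_positive1 : face_positive 1.
Proof. by split=> [|i]; rewrite meval1. Qed.

Lemma face_positiveM P Q : face_positive P -> face_positive Q -> face_positive (P * Q).
Proof.
by move=> [p1 p2] [q1 q2]; split=> [|i]; rewrite mevalM mulr_gt0.
Qed.

(** A Laurent monomial with exponents c is the quotient of the monomials for c and - c. *)
Definition pos_mnm c : 'X_{1..n} := [multinom `|pos_part (c i)|%N | i < n].

Lemma meval_pos_mnm (v : 'I_n -> int) c : ('X_[pos_mnm c] : {mpoly int[n]}).@[v] = \prod_i v i ^ pos_part (c i).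
Proof.
rewrite mevalX; apply: eq_bigr => i _; rewrite mnmE exprnP.
by congr (_ ^ _); rewrite /pos_part; lia.
Qed.

Lemma pos_mnm_at1 c : ('X_[pos_mnm c] : {mpoly int[n]}).@[fun=> 1] = 1.
Proof. by rewrite meval_pos_mnm big1 // => i _; rewrite exp1rz. Qed.

Lemma pos_mnm_face c i : ('X_[pos_mnm c] : {mpoly int[n]}).@[fun j => (j != i)%:R] = (c i <= 0)%R%:R.
Proof.
rewrite meval_pos_mnm (bigD1 i) //= eqxx big1 => [|j ->]; last by rewrite exp1rz.
rewrite mulr1 exp0rz; congr (_%:R); congr nat_of_bool.
by rewrite /pos_part; apply/eqP/idP; lia.
Qed.

(** The two monomials have disjoint supports, so at Z_i = 0 at most one of the summands vanishes. *)
Lemma face_positive_sum c P Q : face_positive P -> face_positive Q ->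
  face_positive ('X_[pos_mnm c] * P + 'X_[pos_mnm (fun i => - c i)] * Q).
Proof.
move=> [p1 p2] [q1 q2]; split=> [|i].
  by rewrite mevalD !mevalM !pos_mnm_at1 !mul1r addr_gt0.
rewrite mevalD !mevalM !pos_mnm_face.
have := p2 i; have := q2 i; set x := P.@[_]; set y := Q.@[_] => hy hx.
by case: (lerP (c i) 0) => h1; case: (lerP (- c i) 0) => h2 /=; lia.
Qed.

Definition face i : {mpoly int[n]} -> {mpoly int[n]} :=
  mmap (@mpolyC n int) (fun j => if j == i then 0 else 'X_j).

Lemma faceM i P Q : face i (P * Q) = face i P * face i Q.
Proof. by rewrite /face rmorphM. Qed.

Lemma face_decomposition i r : exists r', r = face i r + 'X_i * r'.
Proof.
pose T r := exists r', r = face i r + 'X_i * r'.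
have T0 : T 0 by exists 0; rewrite mulr0 addr0 /face mmap0.
have TD r1 r2 : T r1 -> T r2 -> T (r1 + r2).
  move=> [s1 e1] [s2 e2]; exists (s1 + s2).
  by rewrite /face mmapD mulrDr addrACA -/(face i r1) -/(face i r2) -e1 -e2.
have TC (a : int) : T a%:MP by exists 0; rewrite mulr0 addr0 /face mmapC.
have TM r1 r2 : T r1 -> T r2 -> T (r1 * r2).
  move=> [s1 e1] [s2 e2]; exists (face i r1 * s2 + s1 * r2).
  by rewrite faceM mulrDr ['X_i * (_ * s2)]mulrCA addrA -mulrDr -e2 mulrA -mulrDl -e1.
have TX j : T 'X_j.
  rewrite /T /face mmapX mmap1U; case: eqP => [->|_].
    by exists 1; rewrite add0r mulr1.
  by exists 0; rewrite mulr0 addr0.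
have TXm (m : 'X_{1..n}) : T 'X_[m].
  rewrite mpolyXE_id; apply: (big_ind T) => // [|j _]; first exact: (TC 1).
  elim: (m j) => [|k IH]; first exact: (TC 1).
  by rewrite exprS; apply: TM.
by elim/mpolyind: r => // c m p _ _ h; apply: TD => //; rewrite -mul_mpolyC; apply: TM.
Qed.

Lemma face_neq0 i P : face_positive P -> face i P != 0.
Proof.
move=> [_ /(_ i) h]; apply: contraTneq h => e.
have [r' ->] := face_decomposition i P.
by rewrite e add0r mevalM mevalXU eqxx mul0r.
Qed.

Lemma X_neq0 i : 'X_i != 0 :> {mpoly int[n]}.
Proof. by apply/eqP => /(congr1 (mcoeff U_(i))) /eqP; rewrite mcoeffX eqxx mcoeff0. Qed.

(** No Z_i divides Q, so reduction modulo Z_i shows that every Z_i in the monomial divides r; they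
    are cancelled one by one. *)
Lemma face_positive_divides Q r P (m : 'X_{1..n}) :
  face_positive Q -> r * Q = P * 'X_[m] -> exists q, q * Q = P.
Proof.
move=> hQ; have [k] := ubnP (mdeg m); elim: k => // k IH in m r *; rewrite ltnS => hk e.
case: (pickP (fun i => 0 < m i)%N) => [i mi|m0]; last first.
  exists r; rewrite e; have -> : m = 0%MM.
    by apply/mnmP => i; rewrite mnm0E; apply/eqP; rewrite -leqn0 leqNgt m0.
  by rewrite mpolyX0 mulr1.
have em : m = (U_(i) + (m - U_(i)))%MM.
  by rewrite addmC submK //; apply/mnm_lepP => j; rewrite mnm1E; case: eqP => [<-|].
have Fr : face i r = 0.
  have := congr1 (face i) e; rewrite em mpolyXD mulrCA !faceM.
  have -> : face i 'X_i = 0 by rewrite /face mmapX mmap1U eqxx.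
  rewrite mul0r => /eqP; rewrite mulf_eq0.
  by rewrite (negbTE (face_neq0 i hQ)) orbF => /eqP.
have [r' er] := face_decomposition i r.
rewrite Fr add0r in er.
apply: (IH (m - U_(i))%MM r').
  by apply: leq_trans hk; rewrite {2}em mdegD mdeg1.
apply: (mulfI (x := 'X_i)); first by apply: X_neq0.
by rewrite mulrA -er e {1}em mpolyXD mulrCA.
Qed.

End PositiveAtFaces.

(** * Seed patterns *)

Section Tree.
Variable n : nat.
Implicit Types (t : Tn n) (k : 'I_n).

Lemma tree_edge_sym k t t' : tree_edge k t t' = tree_edge k t' t.
Proof. by rewrite /tree_edge orbC. Qed.

Lemma tree_edge_ex k t : exists t', tree_edge k t t'.
Proof.
case: t => s hs; case: s hs => [|a s] hs.
  by exists (exist _ [:: k] isT); rewrite /tree_edge /= eqxx.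
case: (eqVneq k a) => [<-|ne] in hs *.
  by exists (exist _ s (path_sorted hs)); rewrite /tree_edge /= eqxx orbT.
have hs' : sorted (fun i j => i != j) [:: k, a & s] by rewrite /= ne.
by exists (exist _ [:: k, a & s] hs'); rewrite /tree_edge /= eqxx.
Qed.

(** Induction from an arbitrary root: from t0 to the empty word, and from there to any vertex. *)
Lemma tree_ind (Q : Tn n -> Prop) t0 :
  (forall k t t', tree_edge k t t' -> Q t -> Q t') -> Q t0 -> forall t, Q t.
Proof.
move=> step h0.
have edge k s (hs : sorted (fun i j => i != j) (k :: s)) :
    tree_edge k (exist _ s (path_sorted hs) : Tn n) (exist _ (k :: s) hs).
  by rewrite /tree_edge /= eqxx.
have down s (hs : sorted (fun i j => i != j) s) :
    Q (exist _ s hs) -> Q (exist _ [::] isT).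
  elim: s hs => [|k s IH] hs; first by rewrite (bool_irrelevance hs isT).
  move=> h; apply: (IH (path_sorted hs)); apply: step h.
  by rewrite tree_edge_sym; apply: edge.
have up s (hs : sorted (fun i j => i != j) s) :
    Q (exist _ [::] isT) -> Q (exist _ s hs).
  elim: s hs => [|k s IH] hs h; first by rewrite (bool_irrelevance hs isT).
  by apply: (step _ _ _ (edge k s hs)); apply: IH.
by case=> s hs; apply: up; case: t0 h0 => s0 hs0; apply: down.
Qed.

End Tree.

(** * Upper bounds and the Laurent phenomenon *)

Section Pattern.
Variables (F : fieldType) (n : nat).
Notation I := ('I_n + 'I_n)%type.
(* In the index type I, inl l stands for Z_l and inr i for the i-th cluster
   variable; w t is the extended exchange matrix, with the exponents of the
   X_k on top of B. *)
Variables (f : Tn n -> I -> F) (w : Tn n -> I -> 'I_n -> int).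
Implicit Types (t : Tn n) (k i j : 'I_n) (l : I).

Hypothesis char0 : forall m : int, m%:~R = 0 :> F -> m = 0.
Hypothesis find : forall t, indep (f t).
Hypothesis fmut : forall k t t', tree_edge k t t' ->
  f t' (inr k) = binom (f t) (fun l => w t l k) / f t (inr k).
Hypothesis ffix : forall k t t' l, tree_edge k t t' -> l != inr k -> f t' l = f t l.
Hypothesis wmut : forall k t t' l i, tree_edge k t t' ->
  w t' l i = if (l == inr k) || (i == k) then - w t l i
    else w t l i + w t l k * pos_part (w t (inr k) i)
         + pos_part (- w t l k) * w t (inr k) i.
Hypothesis wskew : forall t i j, 0 < w t (inr i) j -> w t (inr j) i < 0.
Hypothesis wskew' : forall t i j, w t (inr i) j < 0 -> 0 < w t (inr j) i.
Variable t0 : Tn n.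
Hypothesis w0 : forall i k, w t0 (inl i) k = (i == k)%:R.

Lemma f_neq0 t l : f t l != 0.
Proof. by case: (find t). Qed.
Local Hint Resolve f_neq0 : core.

Lemma wdiag t i : w t (inr i) i = 0.
Proof.
case: (ltrgt0P (w t (inr i) i)) => // h.
- by have := wskew h; lia.
- by have := wskew' h; lia.
Qed.

Lemma fz t t' i : f t (inl i) = f t' (inl i).
Proof.
move: t; apply: (tree_ind (t0 := t')) => // k t1 t2 e <-.
exact: (ffix e).
Qed.

(** Principal coefficients put an identity block into the matrix at t0, and a relation between the
    columns after a mutation pulls back to one before it. *)
Lemma w_lin t (c : 'I_n -> int) :
  (forall l, \sum_i w t l i * c i = 0) -> forall i, c i = 0.
Proof.
move: t c; apply: (tree_ind (t0 := t0)) => [k t t' e IH c hc|c hc i]; last first.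
  have := hc (inl i); rewrite (bigD1 i) //= big1 => [|j ne].
    by rewrite w0 eqxx mul1r addr0.
  by rewrite w0 eq_sym (negbTE ne) mul0r.
have hk : \sum_i w t (inr k) i * c i = 0.
  have := hc (inr k); under eq_bigr => i _ do rewrite (wmut _ _ e) eqxx /= mulNr.
  by rewrite sumrN => /eqP; rewrite oppr_eq0 => /eqP.
(* The pulled-back relation: collecting the multiples of column k gives its coefficient. The terms
   with pos_part (- w t l k) drop out by [hk], the relation in row k. *)
pose d i := if i == k then - c k + \sum_j pos_part (w t (inr k) j) * c j else c i.
have hd : forall i, d i = 0.
  apply: IH => l; case: (eqVneq l (inr k)) => [->|nl].
    rewrite (bigD1 k) //= wdiag mul0r add0r -[RHS]hk [RHS](bigD1 k) //= wdiag mul0r add0r.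
    by apply: eq_bigr => i /negbTE h; rewrite /d h.
  rewrite -[RHS](hc l) (bigD1 k) //= [RHS](bigD1 k) //= (wmut _ _ e) eqxx orbT.
  have -> : \sum_(i | i != k) w t' l i * c i
     = \sum_(i | i != k) w t l i * d i
       + w t l k * (\sum_(i | i != k) pos_part (w t (inr k) i) * c i)
       + pos_part (- w t l k) * (\sum_(i | i != k) w t (inr k) i * c i).
    rewrite !mulr_sumr -!big_split /=; apply: eq_bigr => i h.
    by rewrite (wmut _ _ e) (negbTE nl) (negbTE h) /d (negbTE h) /=; ring.
  have -> : \sum_(i | i != k) w t (inr k) i * c i = 0.
    by rewrite -[RHS]hk [RHS](bigD1 k) //= wdiag mul0r add0r.
  rewrite /d eqxx [\sum_j _](bigD1 k) //= wdiag /pos_part maxxx; ring.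
have ck i : i != k -> c i = 0 by move=> h; have := hd i; rewrite /d (negbTE h).
move=> i; case: (eqVneq i k) => [->|/ck //].
have := hd k; rewrite /d eqxx big1 => [|j _]; first by rewrite addr0 => /eqP; rewrite oppr_eq0 => /eqP.
case: (eqVneq j k) => [->|/ck ->]; last by rewrite mulr0.
by rewrite wdiag /pos_part maxxx mul0r.
Qed.

Lemma w_col_neq0 t k : exists l, w t l k != 0.
Proof.
apply: NNPP => h.
have /eqP : (k == k)%:R = 0 :> int; last by rewrite eqxx oner_eq0.
apply: (w_lin (t := t) (c := fun i => (i == k)%:R)) => l; apply: big1 => i _.
case: eqP => [->|_]; last by rewrite mulr0.
by rewrite mulr1; apply/eqP; apply: contraT => hl; case: h; exists l.
Qed.

Definition in_star t y : Prop :=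
  Lau (f t) predT y /\ forall k t', tree_edge k t t' -> Lau (f t') predT y.

Lemma edge_fam k t t' t'' : tree_edge k t t' -> tree_edge k t t'' -> f t' =1 f t''.
Proof.
move=> e e' l; case: (eqVneq l (inr k)) => [->|ne]; first by rewrite (fmut e) (fmut e').
by rewrite (ffix e) // (ffix e').
Qed.

Lemma Lau_fam t t' P : f t =1 f t' -> forall y, Lau (f t) P y -> Lau (f t') P y.
Proof. by move=> h y; apply: Lau_mono => // l _; apply: h. Qed.

(** Only the neighbours of t1 along an edge j other than i need an argument. It is the crossing of
    the mutations at i and j, with cases according to the sign of b_ij. *)
Lemma star_step i t t1 y : tree_edge i t t1 -> in_star t y -> in_star t1 y.
Proof.
move=> e [hy hn]; split; first exact: hn e.
move=> j t12 e12; case: (eqVneq i j) => [eij|ij].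
  subst j; rewrite tree_edge_sym in e; exact: (Lau_fam (edge_fam e e12)).
have [t2 e2] := tree_edge_ex j t.
have hy1 := hn _ _ e; have hy2 := hn _ _ e2.
have ij' : inr i != inr j :> I by apply: contra ij => /eqP [->].
have f12j : f t12 (inr j) = binom (f t1) (fun l => w t1 l j) / f t1 (inr j) by apply: fmut.
have ji : j != i by rewrite eq_sym.
have w1 l : w t1 l j = if l == inr i then - w t l j
    else w t l j + w t l i * pos_part (w t (inr i) j) + pos_part (- w t l i) * w t (inr i) j.
  by rewrite (wmut _ _ e) (negbTE ji) orbF.
case: (ltrgt0P (w t (inr i) j)) => hij.
- have hji := wskew hij.
  apply: (@star_fam_dep F _ (inr i) (inr j) ij' (f t) (f t1) (f t2) (f t12)
    (fun l => w t l i) (fun l => w t l j) _ _ _ _ _ _ _ _ _ _ (fun l => w t1 l j)) => //.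
  + exact: fmut.
  + by move=> l; apply: ffix.
  + exact: fmut.
  + by move=> l; apply: ffix.
  + exact: wdiag.
  + exact: wdiag.
  + by rewrite w1 eqxx.
  + by move=> l nl; rewrite w1 (negbTE nl) pos_partN (pos_part_pos (ltW hij)); ring.
  + by move=> l; apply: ffix.
(* Exchange binomials are unchanged when the columns are negated, which reduces this sign to the
   previous case. *)
- have hji := wskew' hij.
  apply: (@star_fam_dep F _ (inr i) (inr j) ij' (f t) (f t1) (f t2) (f t12)
    (fun l => - w t l i) (fun l => - w t l j) _ _ _ _ _ _ _ _ _ _ (fun l => - w t1 l j)) => //.
  + by rewrite binomN; apply: fmut.
  + by move=> l; apply: ffix.
  + by rewrite binomN; apply: fmut.
  + by move=> l; apply: ffix.
  + by rewrite wdiag oppr0.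
  + by rewrite wdiag oppr0.
  + by rewrite oppr_lt0.
  + by rewrite oppr_gt0.
  + by rewrite w1 eqxx.
  + by move=> l nl; rewrite w1 (negbTE nl) (pos_part_neg (ltW hij)); ring.
  + by move=> l; apply: ffix.
  + by rewrite binomN.
- have hji : w t (inr j) i = 0.
    by case: (ltrgt0P (w t (inr j) i)) => // h; [have := wskew h | have := wskew' h]; lia.
  have w1' l : w t1 l j = w t l j.
    by rewrite w1; case: eqP => [->|_]; rewrite hij /pos_part ?maxxx; lia.
  apply: (@star_fam_indep F _ (inr i) (inr j) ij' (f t) (f t1) (f t2) (f t12)
    (fun l => w t l i) (fun l => w t l j)) => //.
  + exact: fmut.
  + by move=> l; apply: ffix.
  + exact: fmut.
  + by move=> l; apply: ffix.
  + exact: wdiag.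
  + exact: wdiag.
  (* A relation between two columns is a relation between all of them with zeros elsewhere. *)
  + move=> c d h.
    have hz := w_lin (t := t) (c := fun m => if m == i then c else if m == j then d else 0) _.
    have hs l : \sum_m w t l m * (if m == i then c else if m == j then d else 0) = 0.
      rewrite (bigD1 i) //= (bigD1 j) //= big1 => [|m /andP[/negbTE -> /negbTE ->]].
        by rewrite !eqxx (negbTE ji) addr0 h.
      by rewrite mulr0.
    by have := hz hs i; have := hz hs j; rewrite !eqxx (negbTE ji).
  + by move=> l; apply: ffix.
  + have ej : f t1 (inr j) = f t (inr j) by apply: (ffix e); rewrite eq_sym.
    rewrite f12j ej; congr (_ / _); rewrite (eq_binom _ w1'); apply: eq_binom_fam => l hl.
    by rewrite (ffix e) //; apply: contraNneq hl => ->; rewrite hij.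
Qed.

Lemma star_all t y : in_star t y -> forall t', in_star t' y.
Proof. by move=> h; apply: tree_ind h => k t1 t2; apply: star_step. Qed.

(** The Laurent phenomenon. A variable of t lies in the upper bound at t, because at the one
    neighbour where it is replaced it equals a binomial over the new variable; upper bounds then
    agree along the tree. *)
Lemma laurent t t' l : Lau (f t') predT (f t l).
Proof.
suff /star_all /(_ t') [] : in_star t (f t l) by [].
split; first exact: Lau_gen.
move=> k t1 e; case: (eqVneq l (inr k)) => [->|ne]; last first.
  by rewrite -(ffix e ne); apply: Lau_gen.
rewrite tree_edge_sym in e; rewrite (fmut e).
have hT := Lau_subring (f t1) predT.
by apply: (subM hT); [apply: binom_Lau | apply: Lau_inv].
Qed.

(** * Divisibility by an initial cluster variable *)

Lemma binom_nonunit t v l : v l != 0 -> ~ Lau (f t) predT (binom (f t) v)^-1.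
Proof.
move=> vl h; have hT := Lau_subring (f t) predT.
have hf := find t; have f0 := f_neq0 t.
pose S := Lau (f t) (off l predT); have hS : subringP S by apply: Lau_subring.
have tl : transc S (f t l) by apply: indep_transc; rewrite // /off /= eqxx.
have hz r : ~~ off l predT r -> zero_at l v r = 0 by rewrite /off andbT negbK /zero_at => ->.
have m0 : mon (f t) (fun l => pos_part (- v l)) != 0 by apply: mon_neq0.
have b0 : binom (f t) v != 0.
  apply/eqP => b0; rewrite binomE // in b0.
  move/eqP: b0; rewrite mulf_eq0 (negbTE m0) /= addrC addr_eq0 => /eqP b0.
  by have := mon_sign_eq (b := true) hf b0 l; apply/eqP.
apply: (@binomial_nonunit F S hS (f t l) tl (f0 l) (mon (f t) (zero_at l v)) (v l)
  (mon (f t) (fun l => pos_part (- v l)) * (binom (f t) v)^-1)) => //.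
- by apply: mon_Lau => r; apply: hz.
- by apply: monV_Lau => r; apply: hz.
- exact: mon_neq0.
- by apply: Lau_laur => //; apply: (subM hT) => //; apply: mon_Lau.
- by rewrite [mon _ _ * _]mulrC -mon_split mulrA [_ * mon _ _]mulrC -binomE // mulfV.
Qed.

(** Rewritten at t', a negative exponent puts the exchange binomial P into the denominator. Clearing
    the other factors would place 1/P in the Laurent ring of t', where P is not a unit. *)
Lemma neighbour_exponent k t t' e : tree_edge k t t' ->
  Lau (f t') predT (mon (f t) e) -> 0 <= e (inr k).
Proof.
move=> ed h; rewrite leNgt; apply/negP => lt.
have hT := Lau_subring (f t') predT.
have ed' := ed; rewrite tree_edge_sym in ed'.
have [l hl] := w_col_neq0 t' k.
apply: (@binom_nonunit t' (fun l => w t' l k) l hl).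
set P := binom _ _.
have [m em] : exists m : nat, e (inr k) = - m.+1%:Z by exists (`|e (inr k)|.-1)%N; lia.
have P0 : P != 0 by have := f_neq0 t (inr k); rewrite (fmut ed') mulf_eq0 negb_or => /andP[].
have hP : Lau (f t') predT P by apply: binom_Lau.
have fm : f t (inr k) ^ e (inr k) = P^-1 * (P ^+ m)^-1 * f t' (inr k) ^+ m.+1.
  by rewrite (fmut ed') -/P em -exprnN expr_div_n exprS; field; nonzero.
have em' : mon (f t) (zero_at (inr k) e) = mon (f t') (zero_at (inr k) e).
  apply: eq_mon_fam => r; rewrite /zero_at; case: (r =P inr k) => [_|/eqP ne _]; first by rewrite eqxx.
  by rewrite (ffix ed).
have -> : P^-1 = mon (f t) e * (mon (f t') (zero_at (inr k) e))^-1 * P ^+ m * (f t' (inr k))^-1 ^+ m.+1.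
  rewrite (mon_split (f t) e (inr k)) em' fm exprVn.
  by field; rewrite ?(mon_neq0 _ (f_neq0 t')) ?expf_neq0 ?P0.
apply: (subM hT); last by apply: (subX hT); apply: Lau_inv.
apply: (subM hT); last exact: (subX hT).
by apply: (subM hT) => //; apply: monV_Lau.
Qed.

(* x / A_k lies in every Laurent ring, so A_k divides the unit x there. *)
Lemma divisible_by_initial k tk t j : tree_edge k t0 tk ->
  Lau (f tk) predT (f t (inr j) / f t0 (inr k)) ->
  exists (b : bool) (c : 'I_n -> int),
    f t0 (inr k) = (-1) ^+ b * (\prod_i f t0 (inl i) ^ c i) * f t (inr j).
Proof.
move=> ek hk; set x := f t (inr j); set a := f t0 (inr k); pose y := x / a.
have x0 : x != 0 by apply: f_neq0.
have a0 : a != 0 by apply: f_neq0.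
(* The hypothesis [hk] is membership at mu_k(t0). At t0 and at its other neighbours A_k is a
   generator and x is Laurent. *)
have /star_all hy : in_star t0 y.
  split.
    apply: (subM (Lau_subring (f t0) predT)); [exact: laurent | exact: Lau_inv].
  move=> i t' e; case: (eqVneq i k) => [ei|ne].
    by subst i; apply: (Lau_fam (edge_fam ek e)).
  apply: (subM (Lau_subring (f t') predT)); first exact: laurent.
  rewrite /a -(ffix e); first exact: Lau_inv.
  by apply: contra ne => /eqP [->].
have ha t' : Lau (f t') predT a by apply: laurent.
have hT := Lau_subring (f t) predT.
have [b [e [_ ea]]] : exists (b : bool) e, (forall l, ~~ predT l -> e l = 0) /\ a = (-1) ^+ b * mon (f t) e.
  apply: (Lau_unit char0 (find t) (ha t) (y := y * x^-1)).
    by apply: (subM hT); [apply: (hy t).1 | apply: Lau_inv].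
  by rewrite /y; field; nonzero.
have sb t' : Lau (f t') predT ((-1) ^+ b).
  have hT' := Lau_subring (f t') predT.
  by apply: (subX hT'); apply: (subN hT'); apply: (sub1 hT').
have mb : (-1) ^+ b * (-1) ^+ b = 1 :> F by rewrite -expr2 sqrr_sign.
have ne1 i : 0 <= e (inr i).
  have [t' e'] := tree_edge_ex i t; apply: (neighbour_exponent e').
  have -> : mon (f t) e = (-1) ^+ b * a by rewrite ea mulrA mb mul1r.
  exact: (subM (Lau_subring (f t') predT)).
have f0 := f_neq0 t.
have ey : y = (-1) ^+ b * mon (f t) (fun l => (l == inr j)%:R - e l).
  rewrite monD // monN /y ea; have -> : mon (f t) (fun l => (l == inr j)%:R) = x.
    rewrite (mon_split _ _ (inr j)) eqxx expr1z /zero_at -[RHS]mulr1; congr (_ * _).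
    by rewrite -(mon0 (f t)); apply: eq_mon => l; case: eqP.
  by rewrite invfM invr_sign mulrCA.
have ne2 i : 0 <= (i == j)%:R - e (inr i).
  have [t' e'] := tree_edge_ex i t.
  have := @neighbour_exponent i t t' (fun l => (l == inr j)%:R - e l) e'.
  have -> : (inr i == inr j :> I) = (i == j) by apply/eqP/eqP => [[]|->].
  apply.
  have -> : mon (f t) (fun l => (l == inr j)%:R - e l) = (-1) ^+ b * y by rewrite ey mulrA mb mul1r.
  by apply: (subM (Lau_subring (f t') predT)) => //; apply: (hy t').1.
(* At the cluster variables the exponents of a and of x / a are non-negative and add up to those of
   x. *)
have ei0 i : i != j -> e (inr i) = 0.
  by move=> h; have := ne1 i; have := ne2 i; rewrite (negbTE h) /=; lia.
have ej : e (inr j) = 0 \/ e (inr j) = 1.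
  by have := ne1 j; have := ne2 j; rewrite eqxx /=; lia.
exists b, (fun i => e (inl i)).
have em : mon (f t) e = (\prod_i f t0 (inl i) ^ e (inl i)) * x ^ e (inr j).
  rewrite /mon big_sumType /=; congr (_ * _); first by apply: eq_bigr => i _; rewrite (fz t t0).
  by rewrite (bigD1 j) //= big1 ?mulr1 // => i /ei0 ->.
case: ej => ej; last by rewrite ea em ej expr1z mulrA.
(* With exponent 0 at x, A_k would be a signed monomial in the Z_i, against independence at t0. *)
exfalso; rewrite em ej expr0z mulr1 in ea.
pose e' l := match l with inl l => - e (inl l) | inr i => (i == k)%:R end.
have := @mon_sign_eq F _ (f t0) e' b (find t0).
have -> : mon (f t0) e' = (-1) ^+ b.
  rewrite /mon big_sumType /= [\prod_(i < n) f t0 (inr i) ^ _](bigD1 k) //= eqxx expr1z.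
  have -> : \prod_(i | i != k) f t0 (inr i) ^ (i == k)%:R = 1 by apply: big1 => i /negbTE ->.
  rewrite mulr1 -/a ea.
  rewrite mulrCA -big_split /= big1 ?mulr1 // => l _.
  by rewrite -expfzDr // addNr expr0z.
by move=> /(_ erefl (inr k)) /=; rewrite eqxx.
Qed.

(** Principal coefficients give Z_k exponent 1 in P_k. The cofactors u and u' are monomials free of
    Z_k and A_k, hence units both at t0 and at mu_k(t0). *)
Lemma initial_binom k : exists u u', [/\ binom (f t0) (fun l => w t0 l k) = f t0 (inl k) * u + u',
   u != 0, u' != 0, forall t, (forall l, l != inr k -> f t l = f t0 l) ->
     Lau (f t) (off (inl k) predT) u /\ Lau (f t) (off (inl k) predT) u^-1
   & forall t, (forall l, l != inr k -> f t l = f t0 l) ->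
     Lau (f t) (off (inl k) predT) u' /\ Lau (f t) (off (inl k) predT) u'^-1].
Proof.
pose p l := pos_part (w t0 l k).
pose q l := pos_part (- w t0 l k).
exists (mon (f t0) (zero_at (inl k) p)), (mon (f t0) q); split.
- by rewrite /binom -/p -/q (mon_split _ _ (inl k)) {1}/p w0 eqxx (pos_part_pos ler01) expr1z.
- exact: mon_neq0.
- exact: mon_neq0.
- move=> t h.
  have -> : mon (f t0) (zero_at (inl k) p) = mon (f t) (zero_at (inl k) p).
    apply: eq_mon_fam => l hl; rewrite h //; apply: contraNneq hl => ->.
    by rewrite /zero_at /= /p wdiag /pos_part maxxx.
  by split; [apply: mon_Lau | apply: monV_Lau]; move=> l; rewrite /off andbT negbK /zero_at => ->.
- move=> t h.
  have -> : mon (f t0) q = mon (f t) q.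
    apply: eq_mon_fam => l hl; rewrite h //; apply: contraNneq hl => ->.
    by rewrite /q wdiag /pos_part oppr0 maxxx.
  by split; [apply: mon_Lau | apply: monV_Lau]; move=> l; rewrite /off andbT negbK => /eqP ->; rewrite /q w0 eqxx.
Qed.

(* P_k is linear in Z_k, hence prime in the Laurent ring of the seed mu_k(t0). *)
Lemma initial_divides_factor k tk (Ms Ns : seq F) (h : 'I_n -> int) :
  tree_edge k t0 tk ->
  (forall x, x \in Ms -> exists t j, x = f t (inr j)) ->
  (forall x, x \in Ns -> exists t j, x = f t (inr j)) ->
  \prod_(x <- Ms) x = \prod_(x <- Ns) x * \prod_i f t0 (inr i) ^ h i ->
  0 < h k ->
  exists2 x, x \in Ms & Lau (f tk) predT (x / f t0 (inr k)).
Proof.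
move=> ek hM hN e hk.
have [u [u' [eP u0 u0' hu hu']]] := initial_binom k.
have [hu1 hu2] := hu tk (fun l h => ffix ek h).
have [hu1' hu2'] := hu' tk (fun l h => ffix ek h).
pose S := Lau (f tk) (off (inl k) predT).
have hS : subringP S by apply: Lau_subring.
have hT := Lau_subring (f tk) predT.
have f0 := f_neq0 tk.
have tS : transc S (f tk (inl k)) by apply: indep_transc; rewrite // /off /= eqxx.
set P := binom _ _ in eP.
have eak : f t0 (inr k) = P / f tk (inr k).
  by rewrite (fmut ek) -/P invf_div mulrC divfK // ; have := f0 (inr k); rewrite (fmut ek) mulf_eq0 negb_or => /andP[].
have P0 : P != 0 by have := f_neq0 t0 (inr k); rewrite eak mulf_eq0 negb_or => /andP[].
have ST x : S x -> Lau (f tk) predT x by apply: Lau_mono.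
have ezth : f tk (inl k) - (- u' / u) = P / u.
  by rewrite eP (fz tk t0); field; nonzero.
(* The cofactor of P/u in the product of [Ms]: one factor A_k of A_k^(h k) is written as P over the
   new variable, the others stay. *)
pose Y := \prod_(x <- Ns) x * (\prod_(i | i != k) f t0 (inr i) ^ h i)
    * f t0 (inr k) ^+ (`|h k|.-1)%N * (f tk (inr k))^-1 * u.
have hY : Lau (f tk) predT Y.
  apply: (subM hT); last exact: ST.
  apply: (subM hT); last exact: Lau_inv.
  apply: (subM hT); last by apply: (subX hT); apply: laurent.
  apply: (subM hT).
    rewrite big_seq; apply: (sub_prod hT) => x /hN [t [j ->]]; exact: laurent.
  apply: (sub_prod hT) => i ne.
  have ne' : inr i != inr k :> I by apply: contra ne => /eqP [->].
  by rewrite -(ffix ek ne'); apply: (subXz hT); [apply: Lau_gen | apply: Lau_inv].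
have [|||||x hx hxl] := @laur_prime F S (f tk (inl k)) (- u' / u) Ms Y hS tS (f0 _).
- by apply: (subM hS) => //; apply: (subN hS).
- by nonzero; rewrite oppr_eq0.
- by move=> x /hM [t [j ->]]; apply: Lau_laur => //; apply: laurent.
- exact: Lau_laur.
- rewrite ezth e (bigD1 k) //= /Y.
  have -> : h k = (`|h k|.-1).+1%:Z by lia.
  rewrite -exprnP exprS /= {1}eak; field; nonzero.
exists x => //; rewrite ezth in hxl.
have -> : x / f t0 (inr k) = x / (P / u) * f tk (inr k) / u.
  by rewrite eak; field; nonzero.
apply: (subM hT); last exact: ST.
apply: (subM hT); last exact: Lau_gen.
exact: (@laur_Lau _ _ (f tk) predT (inl k)).
Qed.


(** * F-polynomials and g-vectors *)

Definition Xh0 k : F := mon (f t0) (fun l => w t0 l k).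
Definition evX (P : {mpoly int[n]}) : F := mmap (intr : int -> F) Xh0 P.
HB.instance Definition _ := GRing.RMorphism.copy evX (mmap (intr : int -> F) Xh0).
Definition A0 (g : 'I_n -> int) : F := \prod_i f t0 (inr i) ^ g i.
(** The coefficients are evaluated at the Xh_j instead of the Z_j: in these coordinates every
    cluster variable is homogeneous in A. *)
Definition ev (p : {mpoly {mpoly int[n]}[n]}) : F := mmap evX (fun i => f t0 (inr i)) p.
HB.instance Definition _ := GRing.RMorphism.copy ev (mmap evX (fun i => f t0 (inr i))).

Hypothesis ev_inj : forall p, ev p = 0 -> p = 0.

Lemma Xh0_neq0 k : Xh0 k != 0. Proof. exact: mon_neq0. Qed.
Local Hint Resolve Xh0_neq0 : core.

Lemma evC P : ev P%:MP = evX P. Proof. exact: mmapC. Qed.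

Lemma evX_inj P : evX P = 0 -> P = 0.
Proof.
rewrite -evC => /ev_inj /(congr1 (mcoeff 0%MM)).
by rewrite mcoeffC eqxx mulr1 mcoeff0.
Qed.

Lemma evX_mon c : evX 'X_[pos_mnm c] = \prod_i Xh0 i ^ pos_part (c i).
Proof.
rewrite /evX mmapX; apply: eq_bigr => i _; rewrite mnmE exprnP.
by congr (_ ^ _); rewrite /pos_part; lia.
Qed.

Lemma ev_mon c : ev 'X_[pos_mnm c] = A0 (fun i => pos_part (c i)).
Proof.
rewrite /ev mmapX; apply: eq_bigr => i _; rewrite mnmE exprnP.
by congr (_ ^ _); rewrite /pos_part; lia.
Qed.

Lemma A0_neq0 g : A0 g != 0.
Proof. by apply/prodf_neq0 => i _; apply: expfz_neq0. Qed.
Local Hint Resolve A0_neq0 : core.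

Lemma eq_A0 g g' : g =1 g' -> A0 g = A0 g'.
Proof. by move=> h; apply: eq_bigr => i _; rewrite h. Qed.

Lemma A0D g g' : A0 (fun i => g i + g' i) = A0 g * A0 g'.
Proof. by rewrite /A0 -big_split /=; apply: eq_bigr => i _; rewrite expfzDr. Qed.

Lemma A0N g : A0 (fun i => - g i) = (A0 g)^-1.
Proof. by rewrite /A0 -prodfV; apply: eq_bigr => i _; rewrite invr_expz. Qed.

Lemma A00 : A0 (fun=> 0) = 1.
Proof. by rewrite /A0 big1. Qed.

Lemma A0_sum (d : I -> 'I_n -> int) (e : I -> int) :
  A0 (fun i => \sum_l d l i * e l) = \prod_l A0 (d l) ^ e l.
Proof.
under [RHS]eq_bigr => l _ do rewrite /A0 expz_prod.
rewrite exchange_big /=; apply: eq_bigr => i _.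
elim/big_rec2: _ => [|l x y _ <-]; first by rewrite expr0z.
by rewrite expfzDr // exprz_exp.
Qed.

Lemma prod_pos_part (g : 'I_n -> F) c : (forall i, g i != 0) ->
  \prod_i g i ^ pos_part (c i) = \prod_i g i ^ c i * \prod_i g i ^ pos_part (- c i).
Proof.
move=> g0; rewrite -big_split /=; apply: eq_bigr => i _; rewrite -expfzDr //.
by congr (_ ^ _); rewrite pos_partN; ring.
Qed.

(** Independence of the A_i and Xh_j separates the A-monomial from its coefficient; N shifts all
    exponents to non-negative ones. *)
Lemma evX_A0_inj P Q g h : P != 0 -> Q != 0 -> evX P * A0 g = evX Q * A0 h -> P = Q.
Proof.
move=> P0 Q0 e.
pose N i := `|g i| + `|h i|.
have hN (u : 'I_n -> int) : (forall i, - N i <= u i) -> ev 'X_[pos_mnm (fun i => u i + N i)] = A0 u * A0 N.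
  move=> hu; rewrite ev_mon -A0D; apply: eq_A0 => i.
  by apply: pos_part_pos; have := hu i; lia.
set mg := pos_mnm (fun i => g i + N i); set mh := pos_mnm (fun i => h i + N i).
have : ev (P%:MP * 'X_[mg] - Q%:MP * 'X_[mh]) = 0.
  rewrite rmorphB !rmorphM /= !evC !hN; last 2 first.
  - by move=> i; rewrite /N; lia.
  - by move=> i; rewrite /N; lia.
  by rewrite !mulrA e subrr.
move/ev_inj/eqP; rewrite subr_eq0 => /eqP /(congr1 (mcoeff mg)).
rewrite !mcoeffCM !mcoeffX eqxx mulr1; case: eqP => _; rewrite ?mulr1 // mulr0.
by move=> P00; rewrite P00 eqxx in P0.
Qed.

(** Fractions, because mutation divides by the old variable; [g_F_exist] later replaces them by
    polynomials. *)
Definition positive_frac (phi : F) : Prop :=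
  exists P Q, [/\ face_positive P, face_positive Q & phi * evX Q = evX P].

Lemma evX_positive P : face_positive P -> evX P != 0.
Proof. by move/face_positive_neq0; apply: contraNneq => /evX_inj ->. Qed.

Lemma positive_frac_neq0 phi : positive_frac phi -> phi != 0.
Proof.
move=> [P [Q [hP hQ e]]]; apply: contraTneq (evX_positive hP) => phi0.
by rewrite -e phi0 mul0r eqxx.
Qed.

Lemma positive_frac1 : positive_frac 1.
Proof.
by exists 1, 1; rewrite mul1r; split=> //; apply: face_positive1.
Qed.

Lemma positive_fracM phi psi : positive_frac phi -> positive_frac psi -> positive_frac (phi * psi).
Proof.
move=> [P [Q [hP hQ e]]] [P' [Q' [hP' hQ' e']]]; exists (P * P'), (Q * Q').
split; try exact: face_positiveM.
by rewrite !rmorphM /= -e -e' mulrACA.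
Qed.

Lemma positive_fracV phi : positive_frac phi -> positive_frac phi^-1.
Proof.
move=> h; have phi0 := positive_frac_neq0 h; have [P [Q [hP hQ e]]] := h.
by exists Q, P; split=> //; rewrite -e mulKf.
Qed.

Lemma positive_fracX phi (m : int) : positive_frac phi -> positive_frac (phi ^ m).
Proof.
have nat_pow (psi : F) (q : nat) : positive_frac psi -> positive_frac (psi ^+ q).
  move=> h; elim: q => [|q IH]; first by rewrite expr0; apply: positive_frac1.
  by rewrite exprS; apply: positive_fracM.
move=> h; case: m => k; first by rewrite -exprnP; apply: nat_pow.
by rewrite NegzE -exprnN -exprVn; apply: nat_pow; apply: positive_fracV.
Qed.

Lemma positive_frac_sum c phi psi : positive_frac phi -> positive_frac psi ->
  positive_frac (\prod_i Xh0 i ^ pos_part (c i) * phi + \prod_i Xh0 i ^ pos_part (- c i) * psi).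
Proof.
move=> [P [Q [hP hQ e]]] [P' [Q' [hP' hQ' e']]].
exists ('X_[pos_mnm c] * (P * Q') + 'X_[pos_mnm (fun i => - c i)] * (P' * Q)), (Q * Q').
split; [|exact: face_positiveM|].
  by apply: face_positive_sum; apply: face_positiveM.
by rewrite rmorphD !rmorphM /= -e -e' !evX_mon; ring.
Qed.

Lemma Xh0E k : Xh0 k = f t0 (inl k) * A0 (fun i => w t0 (inr i) k).
Proof.
rewrite /Xh0 /mon big_sumType /=; congr (_ * _).
rewrite (bigD1 k) //= w0 eqxx expr1z big1 ?mulr1 // => i ne.
by rewrite w0 (negbTE ne).
Qed.

(* d l is the degree of the generator l for the Z^n-grading in which A_i has
   degree e_i and the Xh_j have degree 0. *)
Lemma homogeneous t : exists d : I -> 'I_n -> int,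
  [/\ forall j i, d (inl j) i = - w t0 (inr i) j,
      forall k i, \sum_l d l i * w t l k = 0
    & forall j, exists2 phi, positive_frac phi & f t (inr j) = A0 (d (inr j)) * phi].
Proof.
move: t; apply: (tree_ind (t0 := t0)) => [k t t' e [d [dz dw df]]|]; last first.
  exists (fun l i => match l with inl j => - w t0 (inr i) j | inr j => (i == j)%:R end).
  split=> // [k i|j].
  - rewrite big_sumType /= (bigD1 k) //= w0 eqxx mulr1 big1 => [|j ne]; last by rewrite w0 (negbTE ne) mulr0.
    rewrite (bigD1 i) //= eqxx mul1r big1 => [|j ne]; last by rewrite eq_sym (negbTE ne) mul0r.
    by rewrite !addr0 addNr.
  - exists 1; first exact: positive_frac1.
    rewrite mulr1 /A0 (bigD1 j) //= eqxx expr1z big1 ?mulr1 // => i ne.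
    by rewrite (negbTE ne).
have [phi hphi] : exists phi : 'I_n -> F, forall j, positive_frac (phi j) /\ f t (inr j) = A0 (d (inr j)) * phi j.
  have ex j : exists x, positive_frac x /\ f t (inr j) = A0 (d (inr j)) * x.
    by have [x h1 h2] := df j; exists x.
  by have [g hg] := fin_all_exists ex; exists g.
pose PP i := \sum_l d l i * pos_part (w t l k).
(* The new variable has the degree of the exchange binomial minus that of the old variable, which is
   the mutation rule of g-vectors. *)
pose d' l i := if l == inr k then PP i - d (inr k) i else d l i.
have fl l : f t l = A0 (d l) * match l with inl j => Xh0 j | inr j => phi j end.
  case: l => [j|j]; last exact: (hphi j).2.
  rewrite Xh0E (fz t t0) mulrCA -A0D -[LHS]mulr1; congr (_ * _).
  by rewrite -A00; apply: eq_A0 => i; rewrite dz addNr.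
have monE (u : I -> int) : mon (f t) u = A0 (fun i => \sum_l d l i * u l)
    * (\prod_i Xh0 i ^ u (inl i) * \prod_i phi i ^ u (inr i)).
  rewrite /mon; under eq_bigr => l _ do rewrite fl expfzMl.
  by rewrite big_split /= -A0_sum; congr (_ * _); rewrite big_sumType.
(* The binomial is homogeneous: by [dw] column k has degree 0, so both of its monomials have degree
   PP. *)
have hb : exists2 psi, positive_frac psi & binom (f t) (fun l => w t l k) = A0 PP * psi.
  exists (\prod_i Xh0 i ^ pos_part (w t (inl i) k) * \prod_i phi i ^ pos_part (w t (inr i) k)
     + \prod_i Xh0 i ^ pos_part (- w t (inl i) k) * \prod_i phi i ^ pos_part (- w t (inr i) k)).
    apply: positive_frac_sum;
      (apply: (big_ind positive_frac) => [|x y|j _]; [exact: positive_frac1 | exact: positive_fracM |]);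
      by apply: positive_fracX; apply: (hphi j).1.
  rewrite /binom !monE mulrDr; congr (_ + _ * _); apply: eq_A0 => i.
  rewrite /PP; apply/eqP; rewrite -subr_eq0 -sumrB; apply/eqP.
  rewrite -[RHS]oppr0 -[in RHS](dw k i) -sumrN; apply: eq_bigr => l _.
  by rewrite pos_partN; ring.
exists d'; split.
- by move=> j i; rewrite /d' /= dz.
- move=> m i; rewrite (bigD1 (inr k)) //= /d' eqxx (wmut _ _ e) eqxx /=.
  have dk : \sum_(l | l != inr k) d l i * w t l k = 0.
    by rewrite -[RHS](dw k i) [RHS](bigD1 (inr k)) //= wdiag mulr0 add0r.
  have dm : \sum_(l | l != inr k) d l i * w t l m = - (d (inr k) i * w t (inr k) m).
    by have := dw m i; rewrite (bigD1 (inr k)) //= => /eqP; rewrite addrC addr_eq0 => /eqP.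
  have ePP : PP i = \sum_(l | l != inr k) d l i * pos_part (w t l k).
    by rewrite /PP (bigD1 (inr k)) //= wdiag pos_part_neg // mulr0 add0r.
  have ePN : \sum_(l | l != inr k) d l i * pos_part (- w t l k) = PP i.
    rewrite ePP; apply/eqP; rewrite -subr_eq0 -sumrB; apply/eqP.
    rewrite -[RHS]oppr0 -[in RHS]dk -sumrN; apply: eq_bigr => l _.
    by rewrite pos_partN; ring.
  have -> : \sum_(l | l != inr k) (if l == inr k then PP i - d (inr k) i else d l i) * w t' l m
     = if m == k then 0 else - (d (inr k) i * w t (inr k) m) + PP i * w t (inr k) m.
    case: eqP => [->|/eqP nm].
      rewrite -[RHS]oppr0 -[in RHS]dk -sumrN; apply: eq_bigr => l nl.
      by rewrite (negbTE nl) (wmut _ _ e) eqxx orbT mulrN.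
    have -> : \sum_(l | l != inr k) (if l == inr k then PP i - d (inr k) i else d l i) * w t' l m
       = \sum_(l | l != inr k) d l i * w t l m
         + pos_part (w t (inr k) m) * \sum_(l | l != inr k) d l i * w t l k
         + (\sum_(l | l != inr k) d l i * pos_part (- w t l k)) * w t (inr k) m.
      rewrite mulr_sumr mulr_suml -!big_split /=; apply: eq_bigr => l nl.
      by rewrite (negbTE nl) (wmut _ _ e) (negbTE nl) (negbTE nm) /=; ring.
    by rewrite dm dk ePN mulr0 addr0.
  by case: eqP => [->|_]; rewrite ?wdiag; ring.
- move=> j; rewrite /d'; case: eqP => [[->]|ne]; last first.
    have ne' : inr j != inr k :> I by apply/eqP.
    have [h1 h2] := hphi j; by rewrite (ffix e) //; exists (phi j).
  have [psi hpsi eb] := hb; exists (psi / phi k).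
    by apply: positive_fracM => //; apply: positive_fracV; apply: (hphi k).1.
  rewrite (fmut e) eb (hphi k).2 A0D A0N.
  have := positive_frac_neq0 (hphi k).1 => p0.
  by field; nonzero.
Qed.

(** Since Z_j = Xh_j A^(-b_j), a Laurent polynomial in Z and A is one in Xh and A; m and a clear its
    denominator. *)
Lemma Lau_ev x : Lau (f t0) predT x ->
  exists m a p, x * evX 'X_[m] * ev 'X_[a] = ev p.
Proof.
move=> /(_ (fun x => exists m a p, x * evX 'X_[m] * ev 'X_[a] = ev p)); apply.
- split.
  + by exists 0%MM, 0%MM, 1; rewrite !mpolyX0 !rmorph1 !mulr1.
  + move=> y y' [m [a [p e]]] [m' [a' [p' e']]].
    exists (m + m')%MM, (a + a')%MM, (p * 'X_[m']%:MP * 'X_[a'] - p' * 'X_[m]%:MP * 'X_[a]).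
    rewrite rmorphB !rmorphM /= -e -e' !evC !mpolyXD !rmorphM /=; ring.
  + move=> y y' [m [a [p e]]] [m' [a' [p' e']]].
    exists (m + m')%MM, (a + a')%MM, (p * p').
    rewrite !rmorphM /= -e -e' !mpolyXD !rmorphM /=; ring.
- move=> [j|j] _; split.
  + pose b i := w t0 (inr i) j.
    exists 0%MM, (pos_mnm b), (('X_j)%:MP * 'X_[pos_mnm (fun i => - b i)]).
    rewrite mpolyX0 rmorph1 mulr1 rmorphM /= evC !ev_mon /evX mmapX mmap1U Xh0E -/b.
    rewrite -mulrA -A0D; congr (_ * _); apply: eq_A0 => i; rewrite pos_partN; ring.
  + pose b i := w t0 (inr i) j.
    exists U_(j)%MM, (pos_mnm (fun i => - b i)), 'X_[pos_mnm b].
    rewrite !ev_mon /evX mmapX mmap1U Xh0E -/b mulKf // -A0D; apply: eq_A0 => i; rewrite pos_partN; ring.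
  + exists 0%MM, 0%MM, 'X_j; rewrite !mpolyX0 !rmorph1 !mulr1 /ev mmapX mmap1U //.
  + exists 0%MM, U_(j)%MM, 1; rewrite mpolyX0 !rmorph1 mulr1 /ev mmapX mmap1U mulVf //.
Qed.

(** [homogeneous] gives the denominator Q(Xh) and the Laurent phenomenon a monomial one. As no Z_i
    divides Q, the quotient P/Q is a polynomial. *)
Lemma g_F_exist t j : exists g rho, f t (inr j) = A0 g * evX rho.
Proof.
have [d [_ _ /(_ j) [phi [P [Q [hP hQ ephi]]] ex]]] := homogeneous t.
move: (d (inr j)) ex => g ex.
have [m [a [p ep]]] := Lau_ev (@laurent t t0 (inr j)).
set x := f t (inr j) in ex ep *.
have Q0 := evX_positive hQ.
pose ga i := g i + (a i)%:Z.
have ea : ev 'X_[a] = A0 (fun i => (a i)%:Z).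
  by rewrite /ev mmapX; apply: eq_bigr => i _; rewrite exprnP.
have : ev (p * 'X_[pos_mnm (fun i => - ga i)] * Q%:MP - (P * 'X_[m])%:MP * 'X_[pos_mnm ga]) = 0.
  rewrite rmorphB !rmorphM /= -ep ex !evC !ev_mon -ephi ea.
  have -> : A0 (fun i => pos_part (ga i)) = A0 g * A0 (fun i => (a i)%:Z) * A0 (fun i => pos_part (- ga i)).
    by rewrite -!A0D; apply: eq_A0 => i; rewrite pos_partN /ga; ring.
  by ring.
(* The coefficient of this single A-monomial is an equation r Q = P X^m, as [face_positive_divides]
   requires. *)
move/ev_inj/eqP; rewrite subr_eq0 => /eqP /(congr1 (mcoeff (pos_mnm ga))).
rewrite mulrC !mcoeffCM mcoeffX eqxx mulr1 mulrC => e.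
have [rho erho] := face_positive_divides hQ e.
exists g, rho; rewrite ex -erho in ephi *; congr (_ * _).
by apply: (mulIf Q0); rewrite ephi rmorphM.
Qed.

(* Positivity at the faces excludes a sign and a non-trivial coefficient. *)
Lemma coefficient_free k t j (b : bool) (c : 'I_n -> int) :
  f t0 (inr k) = (-1) ^+ b * (\prod_i f t0 (inl i) ^ c i) * f t (inr j) ->
  f t (inr j) = f t0 (inr k).
Proof.
move=> e.
have [d [_ _ /(_ j) [phi [P [Q [hP hQ ephi]]] ex]]] := homogeneous t.
pose dk (i : 'I_n) : int := (i == k)%:R.
have ek : f t0 (inr k) = A0 dk.
  rewrite /A0 (bigD1 k) //= /dk eqxx expr1z big1 ?mulr1 // => i /negbTE -> //.
pose u i := \sum_m - w t0 (inr i) m * c m.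
have ez : \prod_i f t0 (inl i) ^ c i = \prod_i Xh0 i ^ c i * A0 u.
  have -> : A0 u = \prod_m A0 (fun i => - w t0 (inr i) m) ^ c m.
    under [RHS]eq_bigr => l _ do rewrite /A0 expz_prod.
    rewrite exchange_big /=; apply: eq_bigr => i _; rewrite /u.
    elim/big_rec2: _ => [|l x y _ <-]; first by rewrite expr0z.
    by rewrite expfzDr // exprz_exp.
  rewrite -big_split /=; apply: eq_bigr => i _; rewrite -expfzMl Xh0E; congr (_ ^ _).
  by rewrite A0N mulfK.
pose nc i := - c i.
have e1 : evX ('X_[pos_mnm nc] * Q) * A0 dk
    = evX ((-1) ^+ b * 'X_[pos_mnm c] * P) * A0 (fun i => u i + d (inr j) i).
  rewrite -ek e ex ez !rmorphM /= rmorph_sign -ephi !evX_mon (prod_pos_part c) // A0D.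
  rewrite /nc; ring.
have X0 (m : 'X_{1..n}) : 'X_[m] != 0 :> {mpoly int[n]}.
  by apply/eqP => /(congr1 (mcoeff m)) /eqP; rewrite mcoeffX eqxx mcoeff0.
have /evX_A0_inj := e1; rewrite !mulf_neq0 ?signr_eq0 ?X0 ?face_positive_neq0 // => /(_ isT isT) e2.
have [P1 Pf] := hP; have [Q1 Qf] := hQ.
have ms v : (((-1) ^+ b : {mpoly int[n]})).@[v] = (-1) ^+ b.
  by rewrite rmorph_sign.
(* At (1,..,1) all monomials are 1, so the sign relates two positive numbers. *)
have b0 : b = false.
  have := congr1 (meval (fun=> 1)) e2; rewrite !mevalM ms !pos_mnm_at1 mul1r mulr1.
  by case: (b) => // h; move: P1 Q1; rewrite h mulN1r; set y := meval _ _; lia.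
(* At Z_i = 0 exactly one side of [e2] would vanish if c i were non-zero. *)
have c0 i : c i = 0.
  have := congr1 (meval (fun j => (j != i)%:R)) e2; rewrite !mevalM ms !pos_mnm_face b0 expr0 mul1r /nc.
  have := Pf i; have := Qf i; set y := P.@[_]; set z := Q.@[_] => hy hz.
  by case: (lerP (c i) 0) => h1; case: (lerP (- c i) 0) => h2 /=; lia.
rewrite e b0 expr0 mul1r big1 ?mul1r // => i _.
by rewrite c0 expr0z.
Qed.

Lemma noninitial_exponent_le0 k (Ms Ns : seq F) (h : 'I_n -> int) :
  (forall x, x \in Ms -> (exists t j, x = f t (inr j)) /\ forall i, x <> f t0 (inr i)) ->
  (forall x, x \in Ns -> exists t j, x = f t (inr j)) ->
  \prod_(x <- Ms) x = \prod_(x <- Ns) x * A0 h -> h k <= 0.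
Proof.
move=> hM hN e; rewrite leNgt; apply/negP => hk.
have [tk ek] := tree_edge_ex k t0.
have [x hx hl] := initial_divides_factor ek (fun x hx => (hM x hx).1) hN e hk.
have [[t [j ext]] hx0] := hM x hx.
rewrite ext in hl hx0.
have [b [c ec]] := divisible_by_initial ek hl.
exact: (hx0 k (coefficient_free ec)).
Qed.

Lemma noninitial_exponent_eq0 (Ms Ns : seq F) (h : 'I_n -> int) :
  (forall x, x \in Ms -> (exists t j, x = f t (inr j)) /\ forall i, x <> f t0 (inr i)) ->
  (forall x, x \in Ns -> (exists t j, x = f t (inr j)) /\ forall i, x <> f t0 (inr i)) ->
  \prod_(x <- Ms) x = \prod_(x <- Ns) x * A0 h -> forall k, h k = 0.
Proof.
move=> hM hN e k; apply/eqP; rewrite eq_le; apply/andP; split.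
  by apply: (@noninitial_exponent_le0 k Ms Ns h) => // x /hN [].
rewrite -oppr_le0.
apply: (@noninitial_exponent_le0 k Ns Ms (fun i => - h i)) => // [x /hM []|] //.
by rewrite A0N e mulfK.
Qed.

End Pattern.

(** * Algebraic independence over the integers *)

Section Polynomial.
Variables (F : fieldType) (n : nat).

Lemma mmap_map_mpoly (R S : nzRingType) (T : comNzRingType) (g : {rmorphism R -> S})
    (h : {rmorphism S -> T}) (v : 'I_n -> T) (p : {mpoly R[n]}) :
  mmap h v (map_mpoly g p) = mmap (h \o g) v p.
Proof.
elim/mpolyind: p => [|c m p _ _ IH]; first by rewrite !rmorph0.
by rewrite rmorphD !mmapD IH /= map_mpolyZ map_mpolyX !mmapZ !mmapX.
Qed.

Lemma eq_mmap (R : nzRingType) (T : comNzRingType) (g g' : R -> T) (v v' : 'I_n -> T) (p : {mpoly R[n]}) :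
  g =1 g' -> v =1 v' -> mmap g v p = mmap g' v' p.
Proof.
move=> eg ev; apply: eq_bigr => m _; rewrite eg; congr (_ * _).
by apply: eq_bigr => i _; rewrite ev.
Qed.

Notation W := {mpoly {mpoly int[n]}[n]}.
Notation I := ('I_n + 'I_n)%type.
Variables (z A : 'I_n -> F).

Definition evZ (c : {mpoly int[n]}) : F := mmap (intr : int -> F) z c.
HB.instance Definition _ := GRing.RMorphism.copy evZ (mmap (intr : int -> F) z).
Definition evA (p : W) : F := mmap evZ A p.
HB.instance Definition _ := GRing.RMorphism.copy evA (mmap evZ A).
Definition gens (l : I) : F := match l with inl i => z i | inr j => A j end.

Definition var (l : I) : W := match l with inl i => ('X_i)%:MP | inr j => 'X_j end.
Definition isolateZ (l : I) : {mpoly int[n]} -> {poly W} :=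
  mmap (intr : int -> {poly W}) (fun i => if inl i == l then 'X else (var (inl i))%:P).
HB.instance Definition _ l := GRing.RMorphism.copy (isolateZ l)
  (mmap (intr : int -> {poly W}) (fun i => if inl i == l then 'X else (var (inl i))%:P)).
Definition isolate (l : I) : W -> {poly W} :=
  mmap (isolateZ l) (fun i => if inr i == l then 'X else (var (inr i))%:P).
HB.instance Definition _ l := GRing.RMorphism.copy (isolate l)
  (mmap (isolateZ l) (fun i => if inr i == l then 'X else (var (inr i))%:P)).

Lemma isolate_var l l' : isolate l (var l') = if l' == l then 'X else (var l')%:P.
Proof.
case: l' => i; last by rewrite /isolate mmapX mmap1U.
have -> : isolate l (var (inl i)) = isolateZ l 'X_i by exact: mmapC.
by rewrite /isolateZ mmapX mmap1U.
Qed.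

Lemma evA_C c : evA c%:MP = evZ c. Proof. exact: mmapC. Qed.

Hypothesis evA_inj : forall p, evA p = 0 -> p = 0.

Lemma mulW_neq0 (u v : W) : u != 0 -> v != 0 -> u * v != 0.
Proof. by move=> u0 v0; rewrite mulf_eq0 negb_or u0. Qed.

(* isolate l turns the generator l into the variable of {poly W}; S consists of
   fractions free of that generator. *)
Lemma transc_isolate l (S : F -> Prop) :
  (forall x, S x -> exists u v, [/\ v != 0, isolate l u = u%:P, isolate l v = v%:P & x * evA v = evA u]) ->
  transc S (evA (var l)).
Proof.
move=> hS p hp e; have et : isolate l (var l) = 'X by rewrite isolate_var eqxx.
have ex (i : 'I_(size p)) : exists uv : W * W, [/\ uv.2 != 0, isolate l uv.1 = uv.1%:P,
    isolate l uv.2 = uv.2%:P & p`_i * evA uv.2 = evA uv.1].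
  by have [u [v h]] := hS _ (hp i); exists (u, v).
have [g hg] := fin_all_exists ex.
pose D (i : 'I_(size p)) := \prod_(j | j != i) (g j).2.
pose c (i : 'I_(size p)) := (g i).1 * D i.
have isoD i : isolate l (D i) = (D i)%:P.
  by rewrite /D rmorph_prod [RHS]rmorph_prod; apply: eq_bigr => j _; case: (hg j).
have ec (i : 'I_(size p)) : p`_i * evA (\prod_j (g j).2) = evA (c i).
  rewrite (bigD1 i) //= !rmorphM /= mulrA; congr (_ * _); by case: (hg i).
(* Clearing denominators turns the relation into an identity in W; under [isolate] it becomes a
   polynomial identity whose coefficients are the c i. *)
have : \sum_(i < size p) c i * (var l) ^+ i = 0.
  apply: evA_inj; rewrite rmorph_sum /=.
  transitivity (p.[evA (var l)] * evA (\prod_j (g j).2)); last by rewrite e mul0r.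
  rewrite horner_coef mulr_suml; apply: eq_bigr => i _.
  by rewrite rmorphM rmorphXn /= -ec mulrAC.
move/(congr1 (isolate l)); rewrite rmorph_sum rmorph0 /= => ep.
apply/polyP => k; rewrite coef0; have [lt|ge] := ltnP k (size p); last by rewrite nth_default.
have ck : c (Ordinal lt) = 0.
  have := congr1 (fun q : {poly W} => q`_k) ep; rewrite coef_sum coef0 (bigD1 (Ordinal lt)) //= big1.
    rewrite /c !rmorphM rmorphXn /= et isoD; have [_ -> _ _] := hg (Ordinal lt).
    by rewrite -polyCM coefCM coefXn eqxx mulr1 addr0.
  move=> i ne; rewrite /c !rmorphM rmorphXn /= et isoD; have [_ -> _ _] := hg i.
  rewrite -polyCM coefCM coefXn; case: eqP => [h|]; last by rewrite mulr0.
  by case/eqP: ne; apply: val_inj.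
have := ec (Ordinal lt); rewrite ck rmorph0 => /eqP; rewrite mulf_eq0 => /orP[/eqP //|/eqP].
move=> /evA_inj e0; suff : \prod_j (g j).2 != 0 by rewrite e0 eqxx.
apply: (big_ind (fun v : W => v != 0)); [exact: oner_neq0 | exact: mulW_neq0 |].
by move=> i _; have [] := hg i.
Qed.

Lemma indep_gens : indep gens.
Proof.
have ev_var l : evA (var l) = gens l.
  case: l => i /=; first by rewrite evA_C /evZ mmapX mmap1U.
  by rewrite /evA mmapX mmap1U.
have X0 (R : nzRingType) i : 'X_i != 0 :> {mpoly R[n]}.
  by apply/eqP => /(congr1 (mcoeff U_(i))) /eqP; rewrite mcoeffX eqxx mcoeff0 oner_eq0.
have var0 l : var l != 0.
  case: l => i /=; last exact: X0.
  by rewrite mpolyC_eq0; apply: X0.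
have g0 l : gens l != 0.
  by rewrite -ev_var; apply: contraNneq (var0 l) => /evA_inj ->.
split=> // l.
rewrite -[gens l]ev_var.
apply: transc_isolate.
move=> x /(_ (fun x => exists u v, [/\ v != 0, isolate l u = u%:P, isolate l v = v%:P & x * evA v = evA u])).
apply.
- split.
  + by exists 1, 1; split; rewrite ?oner_eq0 ?rmorph1 ?mulr1.
  + move=> y y' [u [v [v0 hu hv e]]] [u' [v' [v0' hu' hv' e']]].
    exists (u * v' - u' * v), (v * v'); split.
    * exact: mulW_neq0.
    * by rewrite !rmorphB !rmorphM /= hu hu' hv hv'.
    * by rewrite !rmorphM /= hv hv'.
    * rewrite !rmorphB !rmorphM /= -e -e'; ring.
  + move=> y y' [u [v [v0 hu hv e]]] [u' [v' [v0' hu' hv' e']]].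
    exists (u * u'), (v * v'); split.
    * exact: mulW_neq0.
    * by rewrite !rmorphM /= hu hu'.
    * by rewrite !rmorphM /= hv hv'.
    * rewrite !rmorphM /= -e -e'; ring.
- move=> l' /negbTE /= ne; split.
  + by exists (var l'), 1; split; rewrite ?oner_eq0 ?rmorph1 ?mulr1 ?isolate_var ?ne ?ev_var.
  + exists 1, (var l'); split; rewrite ?rmorph1 ?isolate_var ?ne ?ev_var ?mulVf //.
    exact: var0.
Qed.

(* Z_j |-> Z_j A^(b_j) permutes Laurent monomials up to a common denominator. *)
Lemma ev_twist_inj (b : 'I_n -> 'I_n -> int) (X : 'I_n -> F) :
  (forall j, X j = z j * \prod_i A i ^ b i j) ->
  forall p : W, mmap (mmap (intr : int -> F) X) A p = 0 -> p = 0.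
Proof.
move=> eX p ep.
have A0 i : A i != 0 by have [h _] := indep_gens; apply: (h (inr i)).
pose s (m : 'X_{1..n}) i : int := \sum_j b i j * m j.
(* A^D is the common denominator: D bounds the exponents s m over all monomials m occurring in p. *)
pose D i : nat := \max_(a <- msupp p) \max_(m <- msupp p@_a) `|s m i|%N.
have hD a m i : a \in msupp p -> m \in msupp p@_a -> 0 <= s m i + (D i)%:Z.
  move=> ha hm.
  have h1 : (`|s m i|%N <= \max_(m <- msupp p@_a) `|s m i|%N)%N by apply: leq_bigmax_seq.
  have h2 : (\max_(m <- msupp p@_a) `|s m i|%N <= D i)%N.
    by apply: (leq_bigmax_seq (F := fun a => \max_(m <- msupp p@_a) `|s m i|)%N).
  by have := leq_trans h1 h2; lia.
pose T (a m : 'X_{1..n}) := [multinom (a i + `|(s m i + (D i)%:Z)%R|)%N | i < n].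
have eT a m : a \in msupp p -> m \in msupp p@_a ->
    \prod_i A i ^+ T a m i = \prod_i A i ^+ a i * \prod_i A i ^ s m i * \prod_i A i ^+ D i.
  move=> ha hm; rewrite -!big_split /=; apply: eq_bigr => i _; rewrite mnmE exprD -mulrA.
  congr (_ * _); rewrite exprnP gez0_abs ?(hD a) // expfzDr //.
have eXm (m : 'X_{1..n}) : \prod_j X j ^+ m j = \prod_j z j ^+ m j * \prod_i A i ^ s m i.
  have -> : \prod_i A i ^ s m i = \prod_j (\prod_i A i ^ b i j) ^+ m j.
    transitivity (\prod_i \prod_j A i ^ (b i j * m j)).
      apply: eq_bigr => i _; rewrite /s.
      by elim/big_rec2: _ => [|j x y _ <-]; rewrite ?expr0z // expfzDr.
    rewrite exchange_big; apply: eq_bigr => j _; rewrite -prodrXl.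
    by apply: eq_bigr => i _; rewrite exprnP exprz_exp.
  by rewrite -big_split; apply: eq_bigr => j _; rewrite eX exprMn.
pose q : W := \sum_(a <- msupp p) \sum_(m <- msupp p@_a) (p@_a@_m *: 'X_[m])%:MP * 'X_[T a m].
have q0 : q = 0.
  apply: evA_inj; transitivity (mmap (mmap (intr : int -> F) X) A p * \prod_i A i ^+ D i); last by rewrite ep mul0r.
  rewrite /q rmorph_sum /= mulr_suml; apply: eq_big_seq => a ha.
  rewrite rmorph_sum /= mulr_suml mulr_suml; apply: eq_big_seq => m hm.
  rewrite rmorphM /= evA_C /evA mmapX /evZ !mmapZ !mmapX /mmap1 eT // eXm; ring.
apply/mpolyP => a; rewrite mcoeff0; apply/mpolyP => m; rewrite mcoeff0.
apply: contraTeq isT => h.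
have hm : m \in msupp p@_a by rewrite mcoeff_msupp.
have ha : a \in msupp p.
  by rewrite mcoeff_msupp; apply: contraNneq h => ->; rewrite mcoeff0.
have := congr1 (fun q : W => q@_(T a m)@_m) q0; rewrite !mcoeff0 /q raddf_sum raddf_sum /=.
have term a' m' : (((p@_a'@_m' *: 'X_[m'])%:MP * 'X_[T a' m'])@_(T a m))@_m
    = if (m' == m) && (T a' m' == T a m) then p@_a'@_m' else 0.
  rewrite mcoeffCM mcoeffX; case: (T a' m' == T a m); rewrite ?mulr1 ?mulr0 ?mcoeff0 ?andbF ?andbT //.
  by rewrite mcoeffZ mcoeffX; case: eqP; rewrite ?mulr1 ?mulr0.
(* For fixed m the map from a to T a m is a translation, so distinct terms of p stay distinct in q
   and keep their coefficients. *)
have Tinj a' : (T a' m == T a m) = (a' == a).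
  apply/eqP/eqP => [/mnmP e|-> //]; apply/mnmP => i.
  by have := e i; rewrite !mnmE => /addIn.
rewrite (bigD1_seq a) ?msupp_uniq //= [X in _ + X]big1_seq ?addr0 => [|a' /andP[ne _]].
  rewrite !raddf_sum /= (bigD1_seq m) ?msupp_uniq //= [X in _ + X]big1_seq ?addr0 => [|m' /andP[ne _]].
    by rewrite term !eqxx /= => e; rewrite e eqxx in h.
  by rewrite term (negbTE ne).
rewrite !raddf_sum /= big1_seq // => m' _; rewrite term.
by case: (m' =P m) => //= ->; rewrite Tinj (negbTE ne).
Qed.

End Polynomial.

(** * Principal coefficients *)

HB.instance Definition _ (K : idomainType) (n : nat) := GRing.RMorphism.copy (@KZ_to_ambient K n)
  (@tofrac {mpoly (KZ K n)[n]} \o @mpolyC n (KZ K n)).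
HB.instance Definition _ (K : idomainType) (n : nat) := GRing.RMorphism.copy (@intZ_to_ambient K n)
  (@KZ_to_ambient K n \o (@tofrac {mpoly K[n]} \o map_mpoly (intr : int -> K))).

Section Ambient.
Variables (K : idomainType) (n : nat).
Notation F := (ambient K n).
Implicit Types S : preseed K n.

Definition Zvar (i : 'I_n) : F := KZ_to_ambient (tofrac ('X_i : {mpoly K[n]})).

Lemma trop_to_ambientE (a : trop n) : trop_to_ambient K a = \prod_i Zvar i ^ a 0 i.
Proof.
rewrite /trop_to_ambient /trop_mon rmorph_prod; apply: eq_bigr => i _.
by rewrite /= fmorphXz.
Qed.

Lemma intZ_to_ambientE (c : {mpoly int[n]}) : intZ_to_ambient K c = evZ Zvar c.
Proof.
rewrite /evZ; elim/mpolyind: c => [|a m c _ _ IH]; first by rewrite !rmorph0.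
rewrite rmorphD mmapD; congr (_ + _); last exact: IH.
rewrite mmapZ mmapX -mul_mpolyC rmorphM /=; congr (_ * _).
  by rewrite /intZ_to_ambient map_mpolyC !rmorph_int.
rewrite mpolyXE_id rmorph_prod /mmap1; apply: eq_bigr => i _ /=.
by rewrite rmorphXn /= /intZ_to_ambient map_mpolyX.
Qed.

Lemma evAE (A : 'I_n -> F) p : mmap (@intZ_to_ambient K n) A p = evA Zvar A p.
Proof. by apply: eq_mmap => // c; rewrite intZ_to_ambientE. Qed.

Hypothesis hchar : [pchar K] =i pred0.

Lemma intr_eq0 (m : int) : m%:~R = 0 :> K -> m = 0.
Proof.
have /pcharf0P h := hchar.
case: m => k; rewrite ?NegzE ?mulrNz => /eqP; last by rewrite oppr_eq0 -pmulrn h.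
by rewrite -pmulrn h => /eqP ->.
Qed.

(** Z[Z] embeds into the group ring in characteristic 0, so freeness over the latter descends. *)
Lemma evA_inj (A : {ffun 'I_n -> F}) : free_generating_set A ->
  forall p, evA Zvar A p = 0 -> p = 0.
Proof.
move=> [hA _] p ep.
pose g : {mpoly int[n]} -> KZ K n := @tofrac {mpoly K[n]} \o map_mpoly (intr : int -> K).
have q0 : map_mpoly g p = 0.
  apply: hA.
    move=> m; rewrite mcoeff_map_mpoly /=; exists (map_mpoly intr p@_m), 0.
    by rewrite /trop_mon big1 ?mulr1 // => i _; rewrite mxE expr0z.
  by rewrite mmap_map_mpoly -[RHS]ep -evAE; apply: eq_mmap.
apply/mpolyP => m; rewrite mcoeff0.
have /eqP := congr1 (mcoeff m) q0; rewrite mcoeff0 mcoeff_map_mpoly /= tofrac_eq0 => /eqP h.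
apply/mpolyP => m'; rewrite mcoeff0; apply: intr_eq0.
by rewrite -mcoeff_map_mpoly h mcoeff0.
Qed.

Definition extB S (l : 'I_n + 'I_n) (k : 'I_n) : int :=
  match l with inl i => seedX S k 0 i | inr j => seedB S j k end.

Lemma sub_min0 (x : int) : x - Num.min 0 x = pos_part x.
Proof. by rewrite /pos_part; lia. Qed.

Lemma opp_min0 (x : int) : - Num.min 0 x = pos_part (- x).
Proof. by rewrite /pos_part; lia. Qed.

(** An exponent x in X_k becomes min(0, x) in 1 oplus X_k, so the two coefficients of P_k have the
    exponents max(x, 0) and max(-x, 0). *)
Lemma exchange_binomialE S k :
  exchange_binomial S k = binom (gens Zvar (seedA S)) (fun l => extB S l k).
Proof.
case: S => B X A; rewrite /binom /mon !big_sumType /= !trop_to_ambientE.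
have pos (e : 'I_n -> int) (P : pred 'I_n) : (forall j, P j = (0 < e j)) ->
    \prod_(j | P j) A j ^ e j = \prod_j A j ^ pos_part (e j).
  move=> hP; rewrite big_mkcond; apply: eq_bigr => j _; rewrite hP.
  by case: ltrP => h; rewrite ?(pos_part_pos (ltW h)) ?(pos_part_neg h).
congr (_ * _ + _ * _); try (apply: eq_bigr => i _; congr (_ ^ _)).
- by rewrite !mxE; apply: sub_min0.
- exact: pos.
- by rewrite !mxE; apply: opp_min0.
- by apply: (pos (fun j => - B j k)) => j; rewrite oppr_gt0.
Qed.

(** The right-hand side is the form in which the coefficients mutate, so that both blocks of the
    extended matrix obey one rule. *)
Lemma sg_max (x y : int) : Num.sg x * Num.max (x * y) 0 = x * pos_part y + pos_part (- x) * y.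
Proof.
have posM u v : 0 <= u -> Num.max (u * v) 0 = u * pos_part v.
  by move=> u0; rewrite /pos_part maxr_pMr // mulr0.
case: (ltrgt0P x) => hx; last by rewrite hx sgr0 oppr0 (@pos_part_neg 0) // !mul0r.
- by rewrite gtr0_sg // posM ?ltW // (@pos_part_neg (- x)) ?oppr_le0 ?ltW // mul0r addr0 mul1r.
- have -> : x * y = - x * - y by rewrite mulrNN.
  rewrite ltr0_sg // posM ?oppr_ge0 ?ltW // (@pos_part_pos (- x)) ?oppr_ge0 ?ltW //.
  by rewrite pos_partN; ring.
Qed.

Lemma extB_mutation S k l i : extB (mutation k S) l i =
  if (l == inr k) || (i == k) then - extB S l i
  else extB S l i + extB S l k * pos_part (extB S (inr k) i)
       + pos_part (- extB S l k) * extB S (inr k) i.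
Proof.
case: S => B X A; case: l => j /=; last first.
  rewrite mxE; have -> : (inr j == inr k :> 'I_n + 'I_n) = (j == k) by apply/eqP/eqP => [[]|->].
  by case: ifP => // _; rewrite sg_max addrA.
rewrite ffunE /=; case: (i =P k) => [->|_]; first by rewrite mxE.
have mz (a : trop n) (m : int) : (a *~ m) 0 j = a 0 j * m.
  case: m => q; rewrite ?NegzE ?mulrNz ?mulNrz; last first.
    by rewrite mxE mulmxnE -mulr_natr mulrN natz.
  by rewrite -pmulrn mulmxnE -mulr_natr natz.
rewrite !mxE !mz mulrN -mulNr !mxE; congr (_ + _ + _ * _).
exact: opp_min0.
Qed.

Lemma skew_sign S i j : skew_symmetrizable (seedB S) ->
  (0 < seedB S i j -> seedB S j i < 0) /\ (seedB S i j < 0 -> 0 < seedB S j i).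
Proof.
have sign (a b x y : int) : 0 < a -> 0 < b -> a * x = - (b * y) ->
    (0 < x -> y < 0) /\ (x < 0 -> 0 < y) by nia.
move=> [d d0 /matrixP /(_ j i)]; rewrite !mxE.
rewrite (bigD1 i) //= big1 => [|m ne]; last by rewrite mxE eq_sym (negbTE ne) mulr0n mul0r.
rewrite (bigD1 j) //= [X in _ = - (_ + X)]big1 => [|m ne]; last by rewrite mxE eq_sym (negbTE ne) mulr0n mul0r.
by rewrite !mxE !eqxx !mulr1n !addr0; apply: sign.
Qed.

End Ambient.

(** * Specialization at A = 1 *)

Section Specialization.
Variables (F : fieldType) (n : nat) (z A : 'I_n -> F).
Hypothesis A_neq0 : forall i, A i != 0.

Lemma evA_mon c : evA z A 'X_[pos_mnm c] = \prod_i A i ^ pos_part (c i).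
Proof.
rewrite /evA mmapX; apply: eq_bigr => i _; rewrite mnmE exprnP.
by congr (_ ^ _); rewrite /pos_part; lia.
Qed.

Lemma meval1_mon (m : 'X_{1..n}) : ('X_[m] : {mpoly {mpoly int[n]}[n]}).@[fun=> 1] = 1.
Proof. by rewrite mevalX big1 // => i _; rewrite expr1n. Qed.

Lemma meval1_mul_mon (p : {mpoly {mpoly int[n]}[n]}) (m : 'X_{1..n}) :
  (p * 'X_[m]).@[fun=> 1] = p.@[fun=> 1].
Proof. by rewrite mevalM meval1_mon mulr1. Qed.

Lemma prod_exprD (a c : 'I_n -> int) : \prod_i A i ^ (a i + c i) = \prod_i A i ^ a i * \prod_i A i ^ c i.
Proof. by rewrite -big_split; apply: eq_bigr => i _; rewrite expfzDr. Qed.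

(** Setting A = 1 sends Xh_j to Z_j and thus rho(Xh) to rho; the polynomials rho with such an
    expansion are closed under sums and products. *)
Lemma specialization_exists (b : 'I_n -> 'I_n -> int) (X : 'I_n -> F) (rho : {mpoly int[n]}) :
  (forall j, X j = z j * \prod_i A i ^ b i j) ->
  exists p (a : 'I_n -> int),
    mmap (intr : int -> F) X rho = evA z A p * \prod_i A i ^ a i /\ p.@[fun=> 1] = rho.
Proof.
move=> eX.
pose T (r : {mpoly int[n]}) := exists p (a : 'I_n -> int),
  mmap (intr : int -> F) X r = evA z A p * \prod_i A i ^ a i /\ p.@[fun=> 1] = r.
have TC (c : {mpoly int[n]}) (a : 'I_n -> int) :
    mmap (intr : int -> F) X c = evZ z c * \prod_i A i ^ a i -> T c.
  by move=> e; exists c%:MP, a; rewrite evA_C mevalC.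
have Tint (m : int) : T m%:MP.
  apply: (TC _ (fun=> 0)); rewrite /evZ !mmapC big1 ?mulr1 //.
have TX j : T 'X_j.
  by apply: (TC _ (fun i => b i j)); rewrite /evZ !mmapX !mmap1U eX.
have TM r1 r2 : T r1 -> T r2 -> T (r1 * r2).
  move=> [p1 [a1 [e1 m1]]] [p2 [a2 [e2 m2]]]; exists (p1 * p2), (fun i => a1 i + a2 i).
  by rewrite mevalM m1 m2 !rmorphM /= e1 e2 prod_exprD mulrACA.
have TD r1 r2 : T r1 -> T r2 -> T (r1 + r2).
  move=> [p1 [a1 [e1 m1]]] [p2 [a2 [e2 m2]]].
  (* A common lower bound of both exponent vectors, so that the two expansions share one
     denominator. *)
  pose c i : int := - `|a1 i| - `|a2 i|.
  have shift (a : 'I_n -> int) : (forall i, c i <= a i) ->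
      \prod_i A i ^ a i = evA z A 'X_[pos_mnm (fun i => a i - c i)] * \prod_i A i ^ c i.
    move=> h; rewrite evA_mon -prod_exprD; apply: eq_bigr => i _; congr (_ ^ _).
    by rewrite pos_part_pos; [ring | rewrite subr_ge0].
  exists (p1 * 'X_[pos_mnm (fun i => a1 i - c i)] + p2 * 'X_[pos_mnm (fun i => a2 i - c i)]), c.
  split; last by rewrite mevalD !meval1_mul_mon m1 m2.
  rewrite !rmorphD !rmorphM /= e1 e2 mulrDl -!mulrA -!shift //.
  - by move=> i; rewrite /c; lia.
  - by move=> i; rewrite /c; lia.
rewrite -/(T rho); elim/mpolyind: rho => [|c m r _ _ IH]; first by rewrite -mpolyC0; apply: Tint.
apply: (TD) => //; rewrite -mul_mpolyC; apply: (TM) => //.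
rewrite mpolyXE_id; apply: (big_ind T) => [|r1 r2|i _]; [by rewrite -mpolyC1; apply: Tint | exact: TM |].
elim: (m i) => [|k IHk]; first by rewrite expr0 -mpolyC1; apply: Tint.
by rewrite exprS; apply: TM.
Qed.

Hypothesis evA_inj0 : forall p, evA z A p = 0 -> p = 0.

(** Two expansions of one element differ by a monomial in A, which becomes 1. This determines the
    value that [Fpoly] chooses. *)
Lemma specialization_unique p p' (a a' : 'I_n -> int) :
  evA z A p * \prod_i A i ^ a i = evA z A p' * \prod_i A i ^ a' i ->
  p.@[fun=> 1] = p'.@[fun=> 1].
Proof.
move=> e.
have shift (c d : 'I_n -> int) : \prod_i A i ^ pos_part (c i - d i)
    = \prod_i A i ^ (c i - d i) * \prod_i A i ^ pos_part (d i - c i).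
  rewrite -prod_exprD; apply: eq_bigr => i _; congr (_ ^ _).
  by rewrite -[d i - c i]opprB pos_partN; ring.
have e0 : evA z A (p * 'X_[pos_mnm (fun i => a i - a' i)] - p' * 'X_[pos_mnm (fun i => a' i - a i)]) = 0.
  rewrite rmorphB !rmorphM /= !evA_mon shift.
  have -> : \prod_i A i ^ (a i - a' i) = \prod_i A i ^ a i * (\prod_i A i ^ a' i)^-1.
    rewrite (prod_exprD a (fun i => - a' i)); congr (_ * _).
    by rewrite -prodfV; apply: eq_bigr => i _; rewrite invr_expz.
  have A'0 : \prod_i A i ^ a' i != 0 by apply/prodf_neq0 => i _; apply: expfz_neq0.
  by rewrite !mulrA e mulfK // subrr.
have /(congr1 (meval (fun=> 1))) := evA_inj0 e0.
by rewrite meval0 mevalB !meval1_mul_mon => /eqP; rewrite subr_eq0 => /eqP.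
Qed.

End Specialization.

Theorem theorem6p1 (K : idomainType) (hK : factorial_domain K)
    (hchar : [pchar K] =i pred0) (n : nat) (Sig : Tn n -> preseed K n)
    (t0 : Tn n) (hSig : seed_pattern Sig)
    (hprin : principal_coefficients Sig t0)
    (Ms Ns : seq (ambient K n))
    (hM : forall x, x \in Ms -> noninitial_cluster_variable Sig t0 x)
    (hN : forall x, x \in Ns -> noninitial_cluster_variable Sig t0 x) :
  \prod_(x <- Ms) Fpoly (Sig t0) x = \prod_(x <- Ns) Fpoly (Sig t0) x ->
  \prod_(x <- Ms) x = \prod_(x <- Ns) x /\
  \sum_(x <- Ms) gvector (Sig t0) x = \sum_(x <- Ns) gvector (Sig t0) x.
Proof.
have [hseed hedge] := hSig.
have inj t := evA_inj hchar (hseed t).2.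
pose f t := gens (@Zvar K n) (seedA (Sig t)).
pose w t l k := extB (Sig t) l k.
have find t : indep (f t) by apply: indep_gens; apply: inj.
have Aneq0 t i : seedA (Sig t) i != 0 by have [h _] := find t; apply: (h (inr i)).
have char0 (m : int) : m%:~R = 0 :> ambient K n -> m = 0.
  move=> h; have /inj : evA (@Zvar K n) (seedA (Sig t0)) m%:~R = 0 by rewrite rmorph_int.
  move=> /(congr1 (meval (fun=> 1))); rewrite rmorph_int meval0.
  by move=> /(congr1 (meval (fun=> 1))); rewrite rmorph_int meval0 intz.
have fmut k t t' : tree_edge k t t' ->
    f t' (inr k) = binom (f t) (fun l => w t l k) / f t (inr k).
  move=> /hedge e; rewrite /f /= e.
  have -> : seedA (mutation k (Sig t)) k = (seedA (Sig t) k)^-1 * exchange_binomial (Sig t) k.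
    by case: (Sig t) => B X A; rewrite /= ffunE eqxx.
  by rewrite exchange_binomialE mulrC.
have ffix k t t' l : tree_edge k t t' -> l != inr k -> f t' l = f t l.
  move=> /hedge e; rewrite /f e; case: l => // j ne /=.
  have /negbTE jk : j != k by apply: contraNneq ne => ->.
  by case: (Sig t) => B X A; rewrite /= ffunE jk.
have wmut k t t' l i : tree_edge k t t' ->
    w t' l i = if (l == inr k) || (i == k) then - w t l i
      else w t l i + w t l k * pos_part (w t (inr k) i) + pos_part (- w t l k) * w t (inr k) i.
  by move=> /hedge e; rewrite /w e extB_mutation.
have wskew t i j : 0 < w t (inr i) j -> w t (inr j) i < 0.
  by case: (skew_sign i j (hseed t).1).
have wskew' t i j : w t (inr i) j < 0 -> 0 < w t (inr j) i.
  by case: (skew_sign i j (hseed t).1).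
have w0 (i k : 'I_n) : w t0 (inl i) k = (i == k)%:R.
  by rewrite /w /= hprin /tropZ mxE eqxx.
have eX j : Xh0 f w t0 j = Zvar K j * \prod_i seedA (Sig t0) i ^ seedB (Sig t0) i j.
  exact: Xh0E.
have ev_inj (p : {mpoly {mpoly int[n]}[n]}) : ev f w t0 p = 0 -> p = 0.
  by apply: (ev_twist_inj (inj t0) eX).
have gF x : (exists t k, x = seedA (Sig t) k) ->
    x = \prod_i seedA (Sig t0) i ^ gvector (Sig t0) x i 0 * evX f w t0 (Fpoly (Sig t0) x).
  move=> [t [j ex]].
  have [g [rho egr]] : exists g rho, x = \prod_i seedA (Sig t0) i ^ g i * evX f w t0 rho.
    have [g [rho e]] := g_F_exist find fmut ffix wmut wskew wskew' w0 ev_inj t j.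
    by exists g, rho; rewrite ex; exact: e.
  have [p [a [epa ep1]]] := specialization_exists (Aneq0 t0) rho eX.
  have spec : is_specialization (Sig t0) x rho.
    exists p, (\col_i (g i + a i)); split=> //.
    rewrite evAE egr /evX epa mulrCA; congr (_ * _).
    by rewrite -prod_exprD //; apply: eq_bigr => i _; rewrite mxE.
  have [p' [a' [ep' eF]]] := epsilon_spec (inhabits 0) _ (ex_intro _ rho spec).
  have eFr : Fpoly (Sig t0) x = rho.
    move: spec => [q [c [eq er]]]; rewrite er [LHS]eF.
    apply: (specialization_unique (Aneq0 t0) (inj t0) (a := fun i => a' i 0) (a' := fun i => c i 0)).
    by rewrite -!evAE -ep' -eq.
  have ehat (r : {mpoly int[n]}) : mmap (intr : int -> ambient K n) (Xhat (Sig t0)) r = evX f w t0 r.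
    apply: eq_mmap => // k; rewrite eX /Xhat trop_to_ambientE; congr (_ * _).
    rewrite (bigD1 k) //= mxE !eqxx expr1z big1 ?mulr1 // => i ne.
    by rewrite mxE (negbTE ne) expr0z.
  have hg : is_gvector (Sig t0) x (\col_i g i).
    rewrite /is_gvector eFr ehat {1}egr; congr (_ * _).
    by apply: eq_bigr => i _; rewrite mxE.
  rewrite -ehat.
  exact: (epsilon_spec (inhabits 0) (is_gvector (Sig t0) x) (ex_intro _ _ hg)).
have gFprod (s : seq (ambient K n)) :
    (forall x, x \in s -> noninitial_cluster_variable Sig t0 x) ->
    \prod_(x <- s) x = \prod_i seedA (Sig t0) i ^ (\sum_(x <- s) gvector (Sig t0) x) i 0
      * evX f w t0 (\prod_(x <- s) Fpoly (Sig t0) x).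
  elim: s => [|x s IH] hs.
    by rewrite !big_nil rmorph1 mulr1 big1 // => i _; rewrite mxE expr0z.
  rewrite !big_cons rmorphM /= IH => [|y hy]; last by apply: hs; rewrite inE hy orbT.
  rewrite {1}(gF x (hs x (mem_head _ _)).1) mulrACA; congr (_ * _).
  by rewrite -prod_exprD //; apply: eq_bigr => i _; rewrite mxE.
move=> eF.
pose gM := \sum_(x <- Ms) gvector (Sig t0) x; pose gN := \sum_(x <- Ns) gvector (Sig t0) x.
have eM : \prod_(x <- Ms) x = \prod_i seedA (Sig t0) i ^ gM i 0
    * evX f w t0 (\prod_(x <- Ns) Fpoly (Sig t0) x) by rewrite -eF; exact: gFprod.
have eN : \prod_(x <- Ns) x = \prod_i seedA (Sig t0) i ^ gN i 0
    * evX f w t0 (\prod_(x <- Ns) Fpoly (Sig t0) x) by exact: gFprod.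
(* Dividing the two factorizations cancels the common F-polynomial and leaves A^h. Once h = 0, both
   conclusions follow. *)
pose h i := gM i 0 - gN i 0.
have gMh i : gM i 0 = gN i 0 + h i by rewrite /h addrC subrK.
have eMN : \prod_(x <- Ms) x = \prod_(x <- Ns) x * A0 f t0 h.
  rewrite eM eN mulrAC; congr (_ * _); rewrite -prod_exprD //.
  by apply: eq_bigr => i _; rewrite gMh.
have h0 := noninitial_exponent_eq0 char0 find fmut ffix wmut wskew wskew' w0 ev_inj hM hN eMN.
split; last first.
  apply: (@etrans _ _ gM) => //; apply: (@etrans _ _ gN) => //.
  by apply/matrixP => i j; rewrite ord1 gMh h0 addr0.
rewrite eMN; have -> : A0 f t0 h = 1 by apply: big1 => i _; rewrite h0 expr0z.
by rewrite mulr1.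
Qed.
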